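(* Let $M\in\mathbb{N}$, $\kappa\in[0,\infty)$, $\Theta=\bigcup_{n\in\mathbb{N}}\mathbb{Z}^n$, let $A$ be a finite nonempty set, let $\mathfrak{D}$ be a nonempty set, let $(\Omega,\mathcal{F},\mathbb{P})$ be a probability space, let $\lambda_d,\delta_d,\mathfrak{R}_d\in[0,\infty)$, $d\in\mathfrak{D}$, and let $(\mathbb{X}_d,\mathcal{X}_d)$, $d\in\mathfrak{D}$, be nonempty measurable spaces. For every $d\in\mathfrak{D}$ let $\mathfrak{w}_d\colon\mathbb{X}_d\to(0,\infty)$ be $\mathcal{X}_d/\mathcal{B}((0,\infty))$-measurable, let $g_d\colon\mathbb{X}_d\times A\to\mathbb{R}$ be $(\mathcal{X}_d\otimes 2^A)/\mathcal{B}(\mathbb{R})$-measurable, let $(\mathcal{F}_d^\theta)_{\theta\in\Theta}$ be independent sub-$\sigma$-algebras of $\mathcal{F}$, and let $X_d^\theta=(X_d^{\theta,x,a}(\omega))_{x\in\mathbb{X}_d,a\in A,\omega\in\Omega}\colon\mathbb{X}_d\times A\times\Omega\to\mathbb{X}_d$, $\theta\in\Theta$, be i.i.d. random fields such that for all $\theta\in\Theta$, $X_d^\theta$ is $(\mathcal{X}_d\otimes 2^A\otimes\mathcal{F}_d^\theta)/\mathcal{X}_d$-measurable. Assume $$M>\frac{\big(1+(\sup_{d\in\mathfrak{D}}\lambda_d\delta_d)(2|A|-1)\big)^2}{\big(1-(\sup_{d\in\mathfrak{D}}\lambda_d\delta_d)\big)^2},$$ and assume for all $d\in\mathfrak{D}$,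 $(x,a)\in\mathbb{X}_d\times A$ that $\max_{b\in A}|g_d(x,b)|\le\kappa\,\mathfrak{w}_d(x)$, $(\mathbb{E}[|\mathfrak{w}_d(X_d^{0,x,a})|^2])^{1/2}\le\lambda_d\mathfrak{w}_d(x)$, and $\sup_{u\in\mathfrak{D}}\lambda_u\delta_u<1$. For every $d\in\mathfrak{D}$ let $Q_{n,d}^\theta\colon\mathbb{X}_d\times A\times\Omega\to\mathbb{R}$, $\theta\in\Theta$, $n\in\mathbb{N}_0$, satisfy for all $n\in\mathbb{N}_0$, $(x,a)\in\mathbb{X}_d\times A$, $\theta\in\Theta$ that $$Q_{n,d}^\theta(x,a)=g_d(x,a)+\sum_{l=0}^{n-1}\frac{\delta_d}{M^{n-l}}\sum_{i=1}^{M^{n-l}}\Big[\max_{b\in A}\big\{Q_{l,d}^{(\theta,l,i)}(X_d^{(\theta,l,i),x,a},b)\big\}-\mathbf{1}_{\mathbb{N}}(l)\max_{b\in A}\big\{Q_{\max\{l-1,0\},d}^{(\theta,-l,i)}(X_d^{(\theta,l,i),x,a},b)\big\}\Big],$$ and let $\mathfrak{C}_{n,d}\in[0,\infty)$, $n\in\mathbb{N}_0$, $d\in\mathfrak{D}$, satisfy for all $n\in\mathbb{N}_0$, $d\in\mathfrak{D}$ that $$\mathfrak{C}_{n,d}\le\sum_{l=0}^{n-1}M^{n-l}\big(\mathfrak{R}_d+\mathfrak{C}_{l,d}+\mathbf{1}_{\mathbb{N}}(l)\mathfrak{C}_{\max\{l-1,0\},d}\big).$$ Then: (i) For every $d\in\mathfrak{D}$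 there exists a unique function $Q_d\colon\mathbb{X}_d\times A\to\mathbb{R}$ which is $(\mathcal{X}_d\otimes 2^A)/\mathcal{B}(\mathbb{R})$-measurable and satisfies for all $(x,a)\in\mathbb{X}_d\times A$ that $\sup_{y\in\mathbb{X}_d}\frac{\max_{b\in A}|Q_d(y,b)|}{\mathfrak{w}_d(y)}<\infty$, $\mathbb{E}[|\max_{b\in A}Q_d(X_d^{0,x,a},b)|]<\infty$, and $$Q_d(x,a)=g_d(x,a)+\delta_d\,\mathbb{E}\Big[\max_{b\in A}Q_d(X_d^{0,x,a},b)\Big].$$ (ii) There exist $N\colon(0,1]\to\mathbb{N}$ and $c\in\mathbb{R}$ such that for all $d\in\mathfrak{D}$, $\varepsilon\in(0,1]$ it holds that $\mathfrak{C}_{N_\varepsilon,d}\le c\,\mathfrak{R}_d\,\varepsilon^{-c}$ and $$\sup_{x\in\mathbb{X}_d}\bigg(\frac{\mathbb{E}\big[\max_{a\in A}|Q_d(x,a)-Q_{N_\varepsilon,d}^0(x,a)|^2\big]}{|\mathfrak{w}_d(x)|^2}\bigg)^{1/2}\le\varepsilon.$$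
   Context: $\mathbb{N}=\{1,2,3,\dots\}$, $\mathbb{N}_0=\mathbb{N}\cup\{0\}$; $2^A$ is the power set of $A$; $\mathbf{1}_{\mathbb{N}}$ is the indicator function of $\mathbb{N}$. Indices in $\Theta$ are concatenated: for $\theta\in\mathbb{Z}^k$, $l,i\in\mathbb{Z}$, $(\theta,l,i)\in\mathbb{Z}^{k+2}\subseteq\Theta$; the index $0$ is $0\in\mathbb{Z}^1\subseteq\Theta$. The argument $\omega$ is suppressed: $Q_{l,d}^\eta(X_d^{\vartheta,x,a},b)$ denotes $\omega\mapsto Q_{l,d}^\eta(X_d^{\vartheta,x,a}(\omega),b,\omega)$. $N_\varepsilon$ denotes $N(\varepsilon)$. Empty sums are $0$. *)

(* Defs.v *)
From HB Require Import structures.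
From mathcomp Require Import all_boot all_order all_algebra.
From mathcomp Require Import all_classical all_reals all_analysis.

Set Implicit Arguments.
Unset Strict Implicit.
Unset Printing Implicit Defensive.

Import Order.TTheory GRing.Theory Num.Theory.
Import numFieldNormedType.Exports.

Local Open Scope classical_set_scope.
Local Open Scope ring_scope.

(* The union over n >= 1 of Z^n, as nonempty finite sequences of integers. *)
Definition Theta : Type := {s : seq int | s != [::]}.

Lemma theta_cat_neq0 (th : Theta) (l i : int) : val th ++ [:: l; i] != [::].
Proof. by case: th => -[]. Qed.

Definition theta_cat (th : Theta) (l i : int) : Theta :=
  exist _ (val th ++ [:: l; i]) (theta_cat_neq0 th l i).

Definition theta0 : Theta := exist _ [:: 0 : int] isT.

(* The maximum of f over a nonempty finite type A. The value f a0 only serves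
   as the starting point of the iteration: the result does not depend on a0. *)
Definition fmax (R : realType) (A : finType) (a0 : A) (f : A -> R) : R :=
  \big[Num.max/f a0]_(a : A) f a.

(* A copy of A carrying the power set sigma-algebra; measurableType is built on
   pointedType, hence the parameter a0. *)
Definition discrete_copy (A : finType) (a0 : A) : Type := A.

HB.instance Definition _ (A : finType) (a0 : A) :=
  Choice.copy (discrete_copy a0) A.
HB.instance Definition _ (A : finType) (a0 : A) :=
  isPointed.Build (discrete_copy a0) a0.
HB.instance Definition _ (A : finType) (a0 : A) :=
  @isMeasurable.Build default_measure_display (discrete_copy a0)
    discrete_measurable discrete_measurable0 discrete_measurableC
    discrete_measurableU.

Definition independent_classes (R : realType) (dO : measure_display)
    (Omega : measurableType dO) (P : probability Omega R)
    (I : eqType) (G : I -> set (set Omega)) : Prop :=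
  forall (J : seq I) (E : I -> set Omega), uniq J ->
    (forall i, i \in J -> G i (E i)) ->
    P (\bigcap_(i in [set` J]) E i) = (\prod_(i <- J) P (E i))%E.

(* The product sigma-algebra on the set of all functions from I to T. *)
Definition function_sigma (I : Type) (dT : measure_display)
    (T : measurableType dT) : set (set (I -> T)) :=
  <<s \bigcup_(i in [set: I])
        preimage_set_system [set: I -> T] (fun f => f i) measurable >>.

(* Random fields Y k, k in K, with index set I and values in T, viewed as
   random elements of (I -> T) with the product sigma-algebra. *)
Definition iid_fields (R : realType) (dO : measure_display)
    (Omega : measurableType dO) (P : probability Omega R) (K : eqType)
    (I : Type) (dT : measure_display) (T : measurableType dT)
    (Y : K -> Omega -> I -> T) : Prop :=
  independent_classes P
    (fun k => preimage_set_system [set: Omega] (Y k) (@function_sigma I dT T)) /\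
  (forall (k k' : K) (C : set (I -> T)), function_sigma C ->
     P (Y k @^-1` C) = P (Y k' @^-1` C)).

(* Q is measurable, has finite w-weighted supremum norm and solves the Bellman
   equation Q(x, a) = g(x, a) + delta * E[max_b Q(Y(x, a), b)]. *)
Definition bellman_solution (R : realType) (dO : measure_display)
    (Omega : measurableType dO) (P : probability Omega R)
    (A : finType) (a0 : A) (dX : measure_display) (X : measurableType dX)
    (w : X -> R) (g : X -> A -> R) (delta : R) (Y : X -> A -> Omega -> X)
    (Q : X -> A -> R) : Prop :=
  measurable_fun [set: X * discrete_copy a0]
    (fun p : X * discrete_copy a0 => Q p.1 p.2) /\
  forall (x : X) (a : A),
    [/\ (ereal_sup (range (fun y : X =>
            (fmax a0 (fun b => `|Q y b|) / w y)%:E)) < +oo)%E,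
        ('E_P[(fun om => `|fmax a0 (Q (Y x a om))|)%R] < +oo)%E &
        (Q x a)%:E =
          ((g x a)%:E
           + delta%:E * 'E_P[(fun om => fmax a0 (Q (Y x a om)))%R])%E].

(* Main.v *)
Require Import Defs.
From HB Require Import structures.
From mathcomp Require Import all_boot all_order all_algebra.
From mathcomp Require Import all_classical all_reals all_analysis.
From mathcomp Require Import measurable_realfun ring lra zify.

(** For each [d] the Bellman operator maps [Q] to
[g x a + delta * E (max_b Q (Y x a) b)]. Since [E (w (Y x a)) <= lambda * w x], it
contracts the supremum norm weighted by [w] with factor [lambda * delta <= s < 1].
Its Picard iterates converge to a measurable fixed point, any two weighted-bounded
fixed points coincide, and every one of them is bounded by [kap / (1 - s) * w]
([bellman_fixpointE], [fixed_unique], [fixed_bound]).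

The random recursion is a multilevel Monte Carlo version of Picard iteration. In
expectation the levels telescope to [g x a + delta * E (max_b Q_(n-1) (Y x a) b)], so
the bias of [Q_n] is at most [lambda * delta] times the error of [Q_(n-1)]. Level [l]
is an average of [M ^ (n - l)] independent terms whose second moments are controlled
by the errors [e_l] and [e_(l-1)], so its standard deviation carries a factor
[r ^ (n - l)] with [r = 1 / sqrt M]. Altogether ([error_step])
[e_n <= lambda * delta * (e_(n-1) + |A| * sum_(l < n) r ^ (n - l) * (e_l + e_(l-1)))],
where the factor [|A|] pays for the maximum over the actions. A geometric sequence
[B * q ^ n] with [q < 1] close to [1] dominates every solution of this recursion as
soon as [s + 2 * s * |A| * r / (1 - r) < 1], which is the hypothesis on [M]
([rate_exists], [rate_recursion]). The cost grows like [(4 * M) ^ n]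
([complexity_bound]), hence polynomially in [1 / eps] when [n] is the first positive
index with [B * q ^ n <= eps] ([polynomial_complexity]). The constants [B], [q] and
the number of levels are chosen from [s], [kappa], [M] and [|A|], hence uniformly
in [d].

Two probabilistic facts support the error recursion. First, [Q n th] depends on the
sigma-algebras [F nu] for strict extensions [nu] of [th] only ([Q_adapted]), and
sigma-algebras gathered over disjoint sets of indices are independent ([group_indep]);
this makes the terms of the double sum independent of each other, and each transition
independent of the approximation evaluated at the state it reaches. Second, the
telescoping requires that the law of the random field [Q n th] does not depend on [th]
([Q_law]). It is proved by induction on [n], the evaluation of a random field at
independent random points being handled by conditioning on the points
([eqlaw_random_argument]). *)

Set Implicit Arguments.
Unset Strict Implicit.
Unset Printing Implicit Defensive.

Import Order.TTheory GRing.Theory Num.Theory.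
Import numFieldNormedType.Exports.

Local Open Scope classical_set_scope.
Local Open Scope ring_scope.

(** * Independence and equality in law *)

Lemma measurable_preimage d1 d2 (T1 : measurableType d1) (T2 : measurableType d2)
    (f : T1 -> T2) (B : set T2) :
  measurable_fun setT f -> measurable B -> measurable (f @^-1` B).
Proof. by move=> mf mB; rewrite -[X in measurable X]setTI; exact: mf. Qed.

Section random_elements.
Context (R : realType) (dO : measure_display) (Omega : measurableType dO)
  (P : probability Omega R).

Definition indep_maps (d1 d2 : measure_display) (T1 : measurableType d1)
    (T2 : measurableType d2) (U : Omega -> T1) (V : Omega -> T2) : Prop :=
  forall A B, measurable A -> measurable B ->
    P ((U @^-1` A) `&` (V @^-1` B)) = (P (U @^-1` A) * P (V @^-1` B))%E.

Definition eqlaw (d : measure_display) (T : measurableType d)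
    (U V : Omega -> T) : Prop :=
  forall B, measurable B -> P (U @^-1` B) = P (V @^-1` B).

Lemma eqlaw_comp d1 d2 (T1 : measurableType d1) (T2 : measurableType d2)
    (U V : Omega -> T1) (f : T1 -> T2) :
  measurable_fun setT f -> eqlaw U V -> eqlaw (f \o U) (f \o V).
Proof. by move=> mf UV B mB; apply: (UV (f @^-1` B)); exact: measurable_preimage. Qed.

Lemma eqlaw_integral d (T : measurableType d) (U V : Omega -> T)
    (f : T -> \bar R) :
  measurable_fun setT U -> measurable_fun setT V -> measurable_fun setT f ->
  eqlaw U V -> (\int[P]_w f (U w) = \int[P]_w f (V w))%E.
Proof.
move=> mU mV mf UV.
have ge0 h : measurable_fun setT h -> (forall y, 0 <= h y)%E ->
    (\int[P]_w h (U w) = \int[P]_w h (V w))%E.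
  move=> mh h0.
  pose U' : {mfun Omega >-> T} := mfun_Sub (mem_set mU).
  pose V' : {mfun Omega >-> T} := mfun_Sub (mem_set mV).
  transitivity (\int[distribution P U']_y h y)%E.
    by rewrite ge0_integral_distribution.
  transitivity (\int[distribution P V']_y h y)%E.
    by apply: eq_measure_integral => B mB _; exact: UV.
  by rewrite ge0_integral_distribution.
rewrite [LHS]integralE [RHS]integralE; congr (_ - _)%E.
  rewrite (funepos_comp f U) (funepos_comp f V).
  by apply: (ge0 f^\+%E) => //; exact: measurable_funepos.
rewrite (funeneg_comp f U) (funeneg_comp f V).
by apply: (ge0 f^\-%E) => //; exact: measurable_funeneg.
Qed.

Section product_law.
Context d1 d2 (T1 : measurableType d1) (T2 : measurableType d2).
Variables (U : Omega -> T1) (V : Omega -> T2).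
Hypotheses (mU : measurable_fun setT U) (mV : measurable_fun setT V).

Let U' : {mfun Omega >-> T1} := mfun_Sub (mem_set mU).
Let V' : {mfun Omega >-> T2} := mfun_Sub (mem_set mV).

(** The joint law and the product of the marginal laws agree on rectangles. Stating it
for a pair [U2, V2] with the marginal laws of [U] and [V] gives both Fubini's theorem
for [(U, V)] and the invariance of the joint law. *)
Let product_lawE (U2 : Omega -> T1) (V2 : Omega -> T2) :
  measurable_fun setT U2 -> measurable_fun setT V2 ->
  indep_maps U2 V2 -> eqlaw U U2 -> eqlaw V V2 ->
  forall X, measurable X -> (distribution P U' \x distribution P V')%E X =
    P ((fun w => (U2 w, V2 w)) @^-1` X).
Proof.
move=> mU2 mV2 UV2 UU2 VV2 X mX.
have mp : measurable_fun setT (fun w => (U2 w, V2 w)).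
  exact: measurable_fun_pair.
pose W : {mfun Omega >-> (T1 * T2)%type} := mfun_Sub (mem_set mp).
rewrite (product_measure_unique (m' := distribution P W))// => A B mA mB.
rewrite -[LHS]/(P ((fun w => (U2 w, V2 w)) @^-1` (A `*` B))).
rewrite (_ : _ @^-1` _ = (U2 @^-1` A) `&` (V2 @^-1` B))// UV2//.
by rewrite -UU2// -VV2.
Qed.

Lemma integral_indep (f : T1 * T2 -> \bar R) :
  indep_maps U V -> measurable_fun setT f -> (forall x, 0 <= f x)%E ->
  (\int[P]_w f (U w, V w) = \int[P]_w1 \int[P]_w2 f (U w1, V w2))%E.
Proof.
move=> UV mf f0.
have mp : measurable_fun setT (fun w => (U w, V w)) by exact: measurable_fun_pair.
pose W : {mfun Omega >-> (T1 * T2)%type} := mfun_Sub (mem_set mp).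
transitivity (\int[distribution P W]_x f x)%E.
  by rewrite ge0_integral_distribution.
transitivity (\int[distribution P U' \x distribution P V']_x f x)%E.
  by apply: eq_measure_integral => X mX _; rewrite -[LHS](product_lawE mU mV).
rewrite fubini_tonelli1// ge0_integral_distribution//=; last 2 first.
- exact: measurable_fun_fubini_tonelli_F.
- by move=> y; apply: integral_ge0.
apply: eq_integral => w _.
by rewrite /fubini_F ge0_integral_distribution//; exact: measurable_fun_pair2.
Qed.

Lemma eqlaw_pair (U2 : Omega -> T1) (V2 : Omega -> T2) :
  measurable_fun setT U2 -> measurable_fun setT V2 ->
  indep_maps U V -> indep_maps U2 V2 -> eqlaw U U2 -> eqlaw V V2 ->
  eqlaw (fun w => (U w, V w)) (fun w => (U2 w, V2 w)).
Proof.
by move=> mU2 mV2 UV UV2 UU2 VV2 B mB; rewrite -product_lawE// -product_lawE.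
Qed.

End product_law.

(** Both sides are finite measures of [A], and finite measures that agree on a
pi-system agree on the sigma-algebra it generates. *)
Lemma indep_generated (C : set (set Omega)) (B : set Omega) :
  C `<=` measurable -> setI_closed C -> C setT -> measurable B ->
  (forall A, C A -> P (A `&` B) = (P A * P B)%E) ->
  forall A, <<s C >> A -> P (A `&` B) = (P A * P B)%E.
Proof.
move=> Cm CI CT mB CB A sA.
have PB0 : 0 <= fine (P B) by exact/fine_ge0/measure_ge0.
have PBE : (fine (P B))%:E = P B by rewrite fineK// fin_num_measure.
pose m2 : {measure set Omega -> \bar R} := mscale (NngNum PB0) P.
transitivity (m2 A); last by rewrite /m2/= /mscale/= PBE muleC.
rewrite -[LHS]/(mrestr P mB A).
apply: (g_sigma_algebra_measure_unique C Cm (fun=> setT) (fun=> CT)) => //.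
- by apply/seteqP; split => // x _; exists 0%N.
- by move=> D CD; rewrite /m2 /= /mrestr /mscale /= CB// PBE muleC.
- move=> _; rewrite /= /mrestr setTI.
  by rewrite (le_lt_trans (probability_le1 P mB))// ltry.
Qed.

Section groups.
Context (K : eqType) (F : K -> set (set Omega)).
Hypotheses (F_sigma : forall k, sigma_algebra setT (F k))
  (F_sub : forall k, F k `<=` measurable) (F_indep : independent_classes P F).

Definition group_gen (I : set K) : set (set Omega) := \bigcup_(k in I) F k.

Let FT k : F k setT.
Proof. by rewrite -(measurable_g_measurableTypeE (F_sigma k)); exact: measurableT. Qed.

Let FI k A B : F k A -> F k B -> F k (A `&` B).
Proof. by rewrite -(measurable_g_measurableTypeE (F_sigma k)); exact: measurableI. Qed.

(** A pi-system that generates the sigma-algebra of the group [I]. The family [E] is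
total, so that two cylinders can be intersected index by index. *)
Let cylinders (I : set K) : set (set Omega) :=
  [set A | exists s E, [/\ uniq s, (forall k, k \in s -> I k),
     (forall k, F k (E k)) & A = \bigcap_(k in [set` s]) E k]].

Let cylindersI I : setI_closed (cylinders I).
Proof.
move=> _ _ [s [E [us sI FE ->]]] [s' [E' [us' sI' FE' ->]]].
exists (undup (s ++ s')), (fun k => (if k \in s then E k else setT) `&`
  (if k \in s' then E' k else setT)); split.
- exact: undup_uniq.
- by move=> k; rewrite mem_undup mem_cat => /orP[/sI|/sI'].
- by move=> k; apply: FI; case: ifPn.
- apply/seteqP; split => x.
    by move=> [xE xE'] k _; split; case: ifPn => //; [exact: xE|exact: xE'].
  move=> xE; split => k /= ks.
    have [|+ _] := xE k; first by rewrite /= mem_undup mem_cat ks.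
    by rewrite ks.
  have [|_] := xE k; first by rewrite /= mem_undup mem_cat ks orbT.
  by rewrite ks.
Qed.

Let cylinders_measurable I : cylinders I `<=` measurable.
Proof.
move=> _ [s [E [us sI FE ->]]]; apply: fin_bigcap_measurable => //.
by move=> k _; exact/F_sub/FE.
Qed.

Let cylindersT I : cylinders I setT.
Proof.
exists [::], (fun=> setT); split => //; apply/seteqP; split => //.
Qed.

Let group_gen_cylinders I : group_gen I `<=` cylinders I.
Proof.
move=> A [k Ik FA].
exists [:: k], (fun j => if j == k then A else setT); split => //.
- by move=> j; rewrite inE => /eqP ->.
- by move=> j; case: eqP => [->|].
- apply/seteqP; split => [x Ax j|x]; first by case: eqP.
  by move=> /(_ k)/=; rewrite inE eqxx; exact.
Qed.

Let cylinders_indep I J A B : I `&` J = set0 -> cylinders I A -> cylinders J B ->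
  P (A `&` B) = (P A * P B)%E.
Proof.
move=> IJ [s [E [us sI FE ->]]] [s' [E' [us' sI' FE' ->]]].
have dis k : k \in s -> k \in s' -> False.
  by move=> /sI Ik /sI' Jk; have : (I `&` J) k by []; rewrite IJ.
pose E2 k := if k \in s then E k else E' k.
have -> : \bigcap_(k in [set` s]) E k `&` \bigcap_(k in [set` s']) E' k =
    \bigcap_(k in [set` s ++ s']) E2 k.
  apply/seteqP; split => x.
    move=> [xE xE'] k /=; rewrite /E2 mem_cat; case: ifPn => [ks _|_ /= ks'].
      exact: xE.
    exact: xE'.
  move=> xE; split => k /= ks; have := xE k; rewrite /= /E2 mem_cat ks ?orbT.
    exact.
  by case: ifPn => [ks' _|_]; [case: (dis _ ks' ks)|exact].
rewrite F_indep; first last.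
- by move=> k _; rewrite /E2; case: ifP.
- rewrite cat_uniq us us' andbT /=; apply/hasPn => k ks'; apply/negP => ks.
  exact: dis ks ks'.
rewrite big_cat/= F_indep// F_indep//; congr (_ * _)%E.
  by apply: eq_big_seq => k ks; rewrite /E2 ks.
apply: eq_big_seq => k ks'; rewrite /E2; case: ifPn => // ks.
by case: (dis _ ks ks').
Qed.

(** Cylinders over disjoint groups are independent by hypothesis; the pi-lambda theorem,
applied to one factor after the other, passes to the generated sigma-algebras. *)
Lemma group_indep I J A B : I `&` J = set0 ->
  <<s group_gen I >> A -> <<s group_gen J >> B -> P (A `&` B) = (P A * P B)%E.
Proof.
move=> IJ sA sB.
have toC L D : <<s group_gen L >> D -> <<s cylinders L >> D.
  by apply: (@sub_sigma_algebra2 _ setT); exact: group_gen_cylinders.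
have mD L D : <<s cylinders L >> D -> measurable D.
  apply: smallest_sub; first exact: sigma_algebra_measurable.
  exact: cylinders_measurable.
apply: (@indep_generated (cylinders I)) (toC _ _ sA) => //.
  exact: mD (toC _ _ sB).
move=> {sA}A cA; rewrite setIC muleC.
apply: (@indep_generated (cylinders J)) (toC _ _ sB) => //.
  exact: cylinders_measurable cA.
by move=> {sB}B cB; rewrite setIC muleC; exact: cylinders_indep cA cB.
Qed.

End groups.
End random_elements.

(** * Maxima over actions and spaces of paths *)

Section fmax_theory.
Context (R : realType) (A : finType) (a0 : A).
Implicit Types (f h : A -> R) (c : R).

Lemma le_fmax f b : f b <= fmax a0 f.
Proof. exact: le_bigmax. Qed.

Lemma fmax_le f c : (forall b, f b <= c) -> fmax a0 f <= c.
Proof. by move=> fc; apply: bigmax_le. Qed.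

Lemma fmaxP f : exists b, fmax a0 f = f b.
Proof.
rewrite /fmax; elim/big_ind: _ => [|_ _ [b ->] [b' ->]|b _]; first by exists a0.
  by rewrite maxEle; case: ifP; [exists b'|exists b].
by exists b.
Qed.

Lemma fmax_dist f h c : (forall b, `|f b - h b| <= c) ->
  `|fmax a0 f - fmax a0 h| <= c.
Proof.
move=> fh; have [b fb] := fmaxP f; have [b' hb'] := fmaxP h.
have := le_fmax f b'; have := le_fmax h b; have := fh b; have := fh b'.
by rewrite fb hb' !ler_norml => /andP[? ?] /andP[? ?] ? ?; apply/andP; split; lra.
Qed.

Lemma fmax_norm_le f c : (forall b, `|f b| <= c) -> `|fmax a0 f| <= c.
Proof. by move=> fc; have [b ->] := fmaxP f. Qed.

Lemma measurable_fmax d (T : measurableType d) (f : A -> T -> R) :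
  (forall b, measurable_fun setT (f b)) ->
  measurable_fun setT (fun t => fmax a0 (f ^~ t)).
Proof.
move=> mf; rewrite /fmax.
elim: (index_enum A) => [|b r IH].
  by under eq_fun do rewrite big_nil; exact: mf.
under eq_fun do rewrite big_cons.
exact: measurable_maxr.
Qed.

End fmax_theory.

(** It generates [function_sigma], here attached to a measurable type so that a random
field is a random element of the space of its paths. *)
Definition fspace_gen (I : Type) (d : measure_display) (T : measurableType d) :
    set (set (I -> T)) :=
  \bigcup_(i in [set: I])
    preimage_set_system [set: I -> T] (fun f => f i) measurable.

Notation fspace I T := (g_sigma_algebraType (@fspace_gen I _ T)).

Section function_space.
Context (I : Type) (d : measure_display) (T : measurableType d).

Lemma measurable_eval (i : I) : measurable_fun setT (fun f : fspace I T => f i).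
Proof.
move=> _ B mB; apply: sub_sigma_algebra; exists i => //.
by exists B.
Qed.

Lemma measurable_fspace d' (S : measurableType d') (h : S -> fspace I T) :
  (forall i, measurable_fun setT (fun s => h s i)) -> measurable_fun setT h.
Proof.
move=> mh.
suff sub : @measurable _ (fspace I T) `<=` [set B | measurable (h @^-1` B)].
  by move=> _ B mB; rewrite setTI; exact: sub.
apply: smallest_sub.
  split => /= [|B mB|B mB].
  - by rewrite preimage_set0; exact: measurable0.
  - by rewrite setTD preimage_setC; exact: measurableC.
  - by rewrite preimage_bigcup; exact: bigcupT_measurable.
by move=> _ [i _ [B mB <-]] /=; rewrite setTI; exact: measurable_preimage (mh i) mB.
Qed.

End function_space.

Section random_argument.
Context (R : realType) (dO : measure_display) (Omega : measurableType dO)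
  (P : probability Omega R).
Context (I : Type) (d : measure_display) (X : measurableType d)
  (d' : measure_display) (T : measurableType d').

Let prob_integral_indic (C : set Omega) : measurable C ->
  (P C = \int[P]_om (\1_C om)%:E)%E.
Proof. by move=> mC; rewrite integral_indic// setIT. Qed.

(** Conditioning on the points: once the points are frozen at [y], only the randomness
of the field [W] is left. *)
Let law_random_argument (G : set (set Omega)) (Y : Omega -> fspace I X)
    (W : X -> Omega -> T) (B : set (fspace I T)) :
  G `<=` measurable -> measurable_fun setT Y ->
  measurable_fun setT (fun p : X * g_sigma_algebraType G => W p.1 p.2) ->
  indep_maps P Y (id : Omega -> g_sigma_algebraType G) ->
  measurable B ->
  let H y := P [set om | B (fun i => W (y i) om)] in
  measurable_fun setT (H : fspace I X -> \bar R) /\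
  (P [set om | B (fun i => W (Y om i) om)] = \int[P]_om H (Y om))%E.
Proof.
move=> Gm mY mW YW mB H.
have mid : measurable_fun setT (id : Omega -> g_sigma_algebraType G).
  move=> _ C sC; rewrite setTI; move: C sC.
  by apply: smallest_sub => //; exact: sigma_algebra_measurable.
pose Phi (p : fspace I X * g_sigma_algebraType G) : fspace I T :=
  fun i => W (p.1 i) p.2.
have mPhi : measurable_fun setT Phi.
  apply: measurable_fspace => i.
  apply: (measurableT_comp (f := fun p : X * g_sigma_algebraType G => W p.1 p.2)
    (g := fun p : fspace I X * g_sigma_algebraType G => (p.1 i, p.2))) => //.
  apply: measurable_fun_pair => //.
  by apply: (measurableT_comp (measurable_eval (T := X) i)).
have mS : measurable (Phi @^-1` B) by exact: measurable_preimage.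
have HE y : H y = (\int[P]_om (\1_(Phi @^-1` B) (y, om))%:E)%E.
  apply: (prob_integral_indic (C := [set om | B (fun i => W (y i) om)])).
  have mYy : measurable_fun setT (fun om : g_sigma_algebraType G => Phi (y, om)).
    by apply: (measurableT_comp mPhi); exact: measurable_fun_pair.
  have := measurable_preimage mYy mB.
  by apply: smallest_sub => //; exact: sigma_algebra_measurable.
split.
  rewrite (_ : H = fun y => (\int[P]_om (\1_(Phi @^-1` B) (y, om))%:E)%E); last first.
    by apply/funext => y; exact: HE.
  pose id' : {mfun Omega >-> g_sigma_algebraType G} := mfun_Sub (mem_set mid).
  have -> : (fun y => (\int[P]_om (\1_(Phi @^-1` B) (y, om))%:E)%E) =
      fubini_F (distribution P id') (fun p => (\1_(Phi @^-1` B) p)%:E); last first.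
    apply: measurable_fun_fubini_tonelli_F => //.
    exact/measurable_EFinP/measurable_indic.
  apply/funext => y; rewrite /fubini_F ge0_integral_distribution//.
  apply/measurable_EFinP.
  by apply: (measurableT_comp (measurable_indic mS)); exact: measurable_fun_pair.
under eq_integral do rewrite HE.
rewrite -(integral_indep mY mid (f := fun p => (\1_(Phi @^-1` B) p)%:E))//.
- apply: (prob_integral_indic (C := [set om | B (fun i => W (Y om i) om)])).
  exact: (measurable_preimage (measurableT_comp mPhi (measurable_fun_pair mY mid)) mB).
- exact/measurable_EFinP/measurable_indic.
Qed.

(** Evaluation of a path at a random point is not measurable on the space of paths, so
the conclusion does not follow from the equality of the laws of the pairs. Joint
measurability of [W] in the point and in [om] is used instead: by Fubini the law is
the average, over the points, of the law of [W] sampled at frozen points, and the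
latter is an image of the law of the field. *)
Lemma eqlaw_random_argument (G G' : set (set Omega))
    (Y Y' : Omega -> fspace I X) (W W' : X -> Omega -> T) :
  G `<=` measurable -> G' `<=` measurable ->
  measurable_fun setT Y -> measurable_fun setT Y' ->
  measurable_fun setT (fun p : X * g_sigma_algebraType G => W p.1 p.2) ->
  measurable_fun setT (fun p : X * g_sigma_algebraType G' => W' p.1 p.2) ->
  indep_maps P Y (id : Omega -> g_sigma_algebraType G) ->
  indep_maps P Y' (id : Omega -> g_sigma_algebraType G') ->
  eqlaw P Y Y' ->
  @eqlaw _ _ _ P _ (fspace X T) (fun om x => W x om) (fun om x => W' x om) ->
  @eqlaw _ _ _ P _ (fspace I T) (fun om i => W (Y om i) om)
    (fun om i => W' (Y' om i) om).
Proof.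
move=> Gm Gm' mY mY' mW mW' iY iY' YY' WW' B mB.
have [mH HE] := law_random_argument Gm mY mW iY mB.
have [mH' HE'] := law_random_argument Gm' mY' mW' iY' mB.
rewrite [LHS]HE [RHS]HE' (eqlaw_integral mY mY' mH YY').
apply: eq_integral => om _.
have mr : measurable_fun setT (fun f : fspace X T => (fun i => f (Y' om i)) : fspace I T).
  by apply: measurable_fspace => i; exact: measurable_eval.
exact: (WW' _ (measurable_preimage mr mB)).
Qed.

End random_argument.

(** * Second moments *)

Section second_moment.
Context (R : realType) (dO : measure_display) (Omega : measurableType dO)
  (P : probability Omega R).
Implicit Types (Z U V : Omega -> R) (v : R).
Local Notation Ex Z := (\int[P]_w Z w).
Local Notation integr Z := (P.-integrable setT (EFin \o Z)).

Lemma integral_RintegralE Z : integr Z -> (\int[P]_w (Z w)%:E = (Ex Z)%:E)%E.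
Proof. by move=> iZ; rewrite /Rintegral fineK// integrable_fin_num. Qed.

Lemma Rintegral_probability_cst v : \int[P]_w v = v.
Proof.
rewrite Rintegral_cst// [X in fine X](_ : _ = 1%E) ?mulr1//.
exact: probability_setT.
Qed.

Lemma probability_integrable_cst v : integr (fun=> v).
Proof. exact: finite_measure_integrable_cst. Qed.

Lemma integrable_add U V : integr U -> integr V -> integr (fun w => U w + V w).
Proof. by move=> iU iV; exact: (integrableD measurableT iU iV). Qed.

Lemma integrable_scale k U : integr U -> integr (fun w => k * U w).
Proof. by move=> iU; exact: (integrableZl measurableT k iU). Qed.

Lemma dom_integrable Z V : measurable_fun setT Z -> (forall w, `|Z w| <= V w) ->
  integr V -> integr Z.
Proof.
move=> mZ ZV; apply: le_integrable => //; first exact/measurable_EFinP.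
by move=> w _ /=; rewrite lee_fin (le_trans (ZV w))// ler_norm.
Qed.

Definition second_moment_le Z v : Prop :=
  measurable_fun setT Z /\ (\int[P]_w ((Z w) ^+ 2)%:E <= v%:E)%E.

Lemma second_moment_integrable_sqr Z v :
  second_moment_le Z v -> integr (fun w => Z w ^+ 2).
Proof.
move=> [mZ Zv]; apply/integrableP; split.
  exact/measurable_EFinP/measurable_funX.
under eq_integral do rewrite /= ger0_norm ?sqr_ge0//.
by rewrite (le_lt_trans Zv)// ltry.
Qed.

Lemma second_moment_integrable Z v : second_moment_le Z v -> integr Z.
Proof.
move=> smZ; have [mZ _] := smZ.
apply: (@dom_integrable _ (fun w => 1 + Z w ^+ 2)) => //.
  by move=> w; rewrite -(real_normK (num_real (Z w))); have := normr_ge0 (Z w); nra.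
apply: integrable_add; first exact: probability_integrable_cst.
exact: second_moment_integrable_sqr smZ.
Qed.

Lemma second_moment_Ex Z v : second_moment_le Z v -> Ex (fun w => Z w ^+ 2) <= v.
Proof.
move=> smZ; have [_] := smZ; rewrite integral_RintegralE ?lee_fin//.
exact: second_moment_integrable_sqr smZ.
Qed.

Lemma second_moment_dom Z V v : measurable_fun setT Z ->
  (forall w, Z w ^+ 2 <= V w) -> integr V -> Ex V <= v -> second_moment_le Z v.
Proof.
move=> mZ ZV iV Vv; split=> //.
apply: (@le_trans _ _ (\int[P]_w (V w)%:E)%E).
  apply: ge0_le_integral => //.
  - by move=> w _; rewrite lee_fin sqr_ge0.
  - exact/measurable_EFinP/measurable_funX.
  - exact: measurable_int iV.
  - by move=> w _; rewrite lee_fin.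
by rewrite integral_RintegralE// lee_fin.
Qed.

(** Minkowski's inequality with known bounds on the norms: integrate
[(u + v) ^ 2 <= (c + e) * (u ^ 2 / c + v ^ 2 / e)]. *)
Lemma second_moment_add Z U V (c e : R) : 0 < c -> 0 < e ->
  measurable_fun setT Z -> (forall w, `|Z w| <= `|U w| + `|V w|) ->
  second_moment_le U (c ^+ 2) -> second_moment_le V (e ^+ 2) ->
  second_moment_le Z ((c + e) ^+ 2).
Proof.
move=> c0 e0 mZ ZUV smU smV.
have iU := second_moment_integrable_sqr smU.
have iV := second_moment_integrable_sqr smV.
have icU := integrable_scale ((c + e) / c) iU.
have icV := integrable_scale ((c + e) / e) iV.
apply: (@second_moment_dom _
  (fun w => (c + e) / c * U w ^+ 2 + (c + e) / e * V w ^+ 2)) => //.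
- move=> w; apply: (@le_trans _ _ ((`|U w| + `|V w|) ^+ 2)).
    by rewrite -[X in X <= _]real_normK ?num_real// ler_sqr ?nnegrE ?addr_ge0.
  rewrite -(real_normK (num_real (U w))) -(real_normK (num_real (V w))).
  move: `|U w| `|V w| => x y.
  rewrite -subr_ge0 (_ : _ - _ = (e * x - c * y) ^+ 2 / (c * e)).
    by rewrite divr_ge0 ?sqr_ge0// mulr_ge0 ?ltW.
  by field; rewrite !gt_eqF.
- exact: (integrable_add icU icV).
- rewrite RintegralD// !RintegralZl//.
  have := second_moment_Ex smU; have := second_moment_Ex smV.
  move: (Ex (fun w => U w ^+ 2)) (Ex (fun w => V w ^+ 2)) => x y ye xc.
  rewrite (_ : (c + e) ^+ 2 = (c + e) / c * c ^+ 2 + (c + e) / e * e ^+ 2).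
    by rewrite lerD// ler_pM2l// divr_gt0// addr_gt0.
  by field; rewrite !gt_eqF.
Qed.

(** Integrate Young's inequality [|z| <= c / 2 + z ^ 2 / (2 * c)]. *)
Lemma second_moment_mean Z (c : R) : 0 < c -> second_moment_le Z (c ^+ 2) ->
  `|Ex Z| <= c.
Proof.
move=> c0 smZ.
have iZ := second_moment_integrable smZ.
have iZ2 := second_moment_integrable_sqr smZ.
have ich := probability_integrable_cst (c / 2).
have icZ := integrable_scale (2 * c)^-1 iZ2.
apply: (le_trans (le_normr_Rintegral measurableT iZ)).
apply: (@le_trans _ _ (Ex (fun w => c / 2 + (2 * c)^-1 * Z w ^+ 2))).
  apply: le_Rintegral => //.
  - exact: (integrable_abse iZ).
  - exact: (integrable_add ich icZ).
  move=> w _; rewrite -(real_normK (num_real (Z w))).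
  move: `|Z w| => x; rewrite -subr_ge0 (_ : _ - _ = (x - c) ^+ 2 / (2 * c)).
    by rewrite divr_ge0 ?sqr_ge0// mulr_ge0// ltW.
  by field; rewrite gt_eqF.
rewrite RintegralD// Rintegral_probability_cst RintegralZl//.
have := second_moment_Ex smZ; move: (Ex (fun w => Z w ^+ 2)) => x xc.
rewrite [leRHS](_ : c = c / 2 + (2 * c)^-1 * c ^+ 2); last first.
  by field; rewrite gt_eqF.
by rewrite lerD2l ler_pM2l// invr_gt0 mulr_gt0.
Qed.

(** The cross term integrates to zero, and a variance is at most a second moment. *)
Lemma second_moment_center V v (u k : R) : second_moment_le V v ->
  (\int[P]_w ((u + k * (V w - Ex V)) ^+ 2)%:E <= (u ^+ 2 + k ^+ 2 * v)%:E)%E.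
Proof.
move=> smV.
have iV := second_moment_integrable smV.
have iV2 := second_moment_integrable_sqr smV.
have V2v := second_moment_Ex smV.
set m := Ex V in V2v *.
have ibV := integrable_scale (2 * k * (u - k * m)) iV.
have ikV := integrable_scale (k ^+ 2) iV2.
have ic := probability_integrable_cst ((u - k * m) ^+ 2).
have ibk := integrable_add ibV ikV.
under eq_integral => w _.
  rewrite (_ : (u + k * (V w - m)) ^+ 2 = (u - k * m) ^+ 2 +
    (2 * k * (u - k * m) * V w + k ^+ 2 * V w ^+ 2)); last by ring.
  over.
rewrite integral_RintegralE; last exact: (integrable_add ic ibk).
rewrite lee_fin RintegralD// RintegralD// Rintegral_probability_cst.
rewrite !RintegralZl// -/m.
by have := sqr_ge0 k; have := sqr_ge0 (k * m); nra.
Qed.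

(** By independence the value of [U] can be frozen while [V] is integrated, which
reduces the claim to [second_moment_center]. *)
Lemma second_moment_indep U V (u v k : R) :
  indep_maps P U V -> second_moment_le U u -> second_moment_le V v ->
  second_moment_le (fun w => U w + k * (V w - Ex V)) (u + k ^+ 2 * v).
Proof.
move=> UV smU smV; have [mU _] := smU; have [mV _] := smV.
have iU2 := second_moment_integrable_sqr smU.
set m := Ex V.
have mf : measurable_fun setT (fun p : R * R => p.1 + k * (p.2 - m)).
  apply: measurable_funD => //; apply: measurable_funM => //.
  exact: measurable_funB.
split.
  apply: measurable_funD => //; apply: measurable_funM => //.
  exact: measurable_funB.
rewrite (integral_indep (f := fun p => ((p.1 + k * (p.2 - m)) ^+ 2)%:E) mU mV UV);
  last 2 first.
- exact/measurable_EFinP/measurable_funX.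
- by move=> p; rewrite lee_fin sqr_ge0.
have iUv := integrable_add iU2 (probability_integrable_cst (k ^+ 2 * v)).
apply: (@le_trans _ _ (\int[P]_w (U w ^+ 2 + k ^+ 2 * v)%:E)%E).
  apply: ge0_le_integral => //.
  - by move=> w _; apply: integral_ge0 => w2 _; rewrite lee_fin sqr_ge0.
  - have mg : measurable_fun setT (fun p : Omega * Omega =>
        ((U p.1 + k * (V p.2 - m)) ^+ 2)%:E).
      apply/measurable_EFinP/measurable_funX/measurable_funD.
        exact: measurableT_comp.
      apply: measurable_funM => //; apply: measurable_funB => //.
      exact: measurableT_comp.
    have g0 (p : Omega * Omega) : (0 <= ((U p.1 + k * (V p.2 - m)) ^+ 2)%:E)%E.
      by rewrite lee_fin sqr_ge0.
    exact: (measurable_fun_fubini_tonelli_F (m2 := P) _ mg g0).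
  - exact: measurable_int iUv.
  - by move=> w _; exact: second_moment_center.
rewrite integral_RintegralE//= lee_fin RintegralD//; last first.
  exact: probability_integrable_cst.
by rewrite Rintegral_probability_cst lerD2r; exact: second_moment_Ex.
Qed.

End second_moment.

Section uniform_second_moment.
Context (R : realType) (dO : measure_display) (Omega : measurableType dO)
  (P : probability Omega R) (A : finType) (a0 : A).

(** Bias and fluctuation, uniformly in [a]: integrate
[(be + z) ^ 2 <= (be + ta) * (be + z ^ 2 / ta)] with [ta = #|A| * si], after bounding
[z ^ 2 = Z a ^ 2] by the sum of the squares over all actions. *)
Lemma fmax_second_moment (b : A -> R) (Z : A -> Omega -> R) (be si : R) :
  0 < be -> 0 < si -> (forall a, `|b a| <= be) ->
  (forall a, second_moment_le P (Z a) (si ^+ 2)) ->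
  (\int[P]_om (fmax a0 (fun a => `|b a + Z a om| ^+ 2))%:E
     <= ((be + #|A|%:R * si) ^+ 2)%:E)%E.
Proof.
move=> be0 si0 bbe smZ.
have mZ a : measurable_fun setT (Z a) by have [] := smZ a.
have A0 : 1 <= #|A|%:R :> R by rewrite ler1n; apply/card_gt0P; exists a0.
set ta := #|A|%:R * si.
have ta0 : 0 < ta by rewrite mulr_gt0// (lt_le_trans ltr01).
have iZ2 a := second_moment_integrable_sqr (smZ a).
have iS : P.-integrable setT (EFin \o (fun om => \sum_a Z a om ^+ 2)).
  rewrite (_ : _ \o _ = fun om => (\sum_a (Z a om ^+ 2)%:E)%E).
    by apply: integrable_sum => // a _; exact: iZ2.
  by apply/funext => om; rewrite /= sumEFin.
have ikS := integrable_scale ((be + ta) / ta) iS.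
have ic := probability_integrable_cst P ((be + ta) * be).
apply: (@le_trans _ _ (\int[P]_om ((be + ta) * be +
    (be + ta) / ta * \sum_a Z a om ^+ 2)%:E)%E).
  apply: ge0_le_integral => //.
  - by move=> om _; rewrite lee_fin (le_trans _ (le_fmax a0 _ a0))// sqr_ge0.
  - apply/measurable_EFinP; apply: (measurable_fmax a0) => a.
    apply: measurable_funX; apply: measurableT_comp => //.
    exact: (measurable_funD (measurable_cst _) (mZ a)).
  - exact: (measurable_int _ (integrable_add ic ikS)).
  move=> om _; rewrite lee_fin; apply: fmax_le => a.
  apply: (@le_trans _ _ ((be + ta) * be + (be + ta) / ta * `|Z a om| ^+ 2)).
    have : `|b a + Z a om| <= be + `|Z a om|.
      by rewrite (le_trans (ler_normD _ _))// lerD2r.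
    move: `|Z a om| => z bz.
    apply: (@le_trans _ _ ((be + z) ^+ 2)).
      have bz0 : 0 <= be + z by rewrite (le_trans _ bz).
      by rewrite ler_sqr.
    rewrite -subr_ge0 (_ : _ - _ = be * (z - ta) ^+ 2 / ta).
      apply: mulr_ge0; last by rewrite invr_ge0 ltW.
      by apply: mulr_ge0; [exact: ltW|exact: sqr_ge0].
    by field; rewrite gt_eqF.
  rewrite lerD2l ler_pM2l ?divr_gt0 ?addr_gt0//.
  rewrite real_normK ?num_real// (bigD1 a)//= lerDl.
  by apply: sumr_ge0 => *; rewrite sqr_ge0.
rewrite integral_RintegralE; last exact: integrable_add.
rewrite lee_fin RintegralD// Rintegral_probability_cst RintegralZl//.
have ES : \int[P]_om (\sum_a Z a om ^+ 2) <= #|A|%:R * si ^+ 2.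
  rewrite /Rintegral; under eq_integral do rewrite -sumEFin.
  rewrite integral_sum//.
  under eq_bigr => a _ do rewrite (integral_RintegralE (iZ2 a)).
  rewrite sumEFin /= (_ : _ * _ = \sum_(a : A) si ^+ 2).
    by apply: ler_sum => a _; exact: second_moment_Ex.
  by rewrite sumr_const mulr_natl.
rewrite (_ : (be + ta) ^+ 2 = (be + ta) * be + (be + ta) / ta * ta ^+ 2).
  rewrite lerD2l ler_pM2l ?divr_gt0 ?addr_gt0//.
  rewrite (le_trans ES)// /ta exprMn ler_wpM2r ?sqr_ge0//.
  by rewrite expr2 ler_peMr// (le_trans ler01).
by field; rewrite gt_eqF.
Qed.

End uniform_second_moment.

Section moment_tools.
Context (R : realType) (dO : measure_display) (Omega : measurableType dO)
  (P : probability Omega R).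

Lemma second_moment_scale (Z V : Omega -> R) (k v : R) : 0 <= k ->
  measurable_fun setT Z -> (forall om, `|Z om| <= k * `|V om|) ->
  second_moment_le P V (v ^+ 2) -> second_moment_le P Z ((k * v) ^+ 2).
Proof.
move=> k0 mZ ZV smV; have iV := second_moment_integrable_sqr smV.
apply: (second_moment_dom mZ (V := fun om => k ^+ 2 * V om ^+ 2)).
- move=> om; rewrite -(real_normK (num_real (Z om))) -(real_normK (num_real (V om))).
  by rewrite -exprMn ler_sqr ?nnegrE ?mulr_ge0.
- exact: integrable_scale.
- rewrite RintegralZl// exprMn ler_wpM2l ?sqr_ge0//.
  exact: second_moment_Ex smV.
Qed.

Lemma eqlaw_Rintegral (U V : Omega -> R) :
  measurable_fun setT U -> measurable_fun setT V -> eqlaw P U V ->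
  \int[P]_om U om = \int[P]_om V om.
Proof.
move=> mU mV UV; rewrite /Rintegral.
by rewrite (eqlaw_integral (f := EFin) mU mV)//.
Qed.

End moment_tools.

Lemma sum_sqr_le (R : realType) (I : Type) (s : seq I) (u : I -> R) :
  (forall i, 0 <= u i) -> \sum_(i <- s) u i ^+ 2 <= (\sum_(i <- s) u i) ^+ 2.
Proof.
move=> u0; elim: s => [|i s IH]; first by rewrite !big_nil expr0n.
rewrite !big_cons sqrrD -addrA lerD2l (le_trans IH)// lerDr.
by rewrite mulrn_wge0// mulr_ge0// sumr_ge0.
Qed.

(** * Groups of indices *)

Section index_groups.
Implicit Types (th nu eta : Theta) (z : int) (l i : nat).

Definition extensions th : set Theta :=
  [set nu | prefix (val th) (val nu) && (val nu != val th)].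

(** The indices whose entries number [k] and [k + 1] are [l], up to sign, and [i]. The
[i]-th term of level [l] in the recursion for an index [th] of length [k] uses only
fields in this branch: signs are dropped because its two approximations carry the
indices [(th, l, i)] and [(th, -l, i)]. *)
Definition branch (k l i : nat) : set Theta :=
  [set nu | (`|nth 0%R (val nu) k|%N == l) && (nth 0%R (val nu) k.+1 == i%:Z)].

Lemma size_theta_cat th z y : size (val (theta_cat th z y)) = (size (val th)).+2.
Proof. by rewrite /= size_cat /= addn2. Qed.

Lemma theta_cat_extensions th z y : extensions th (theta_cat th z y).
Proof.
rewrite /extensions /= prefix_prefix /=; apply/eqP => /(congr1 size).
by rewrite size_cat /=; lia.
Qed.

Lemma extensions_theta_cat th z y :
  extensions (theta_cat th z y) `<=` extensions th.
Proof.
move=> nu /andP[/prefixP[t /= nuE] _].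
rewrite /extensions /= nuE -catA prefix_prefix /=.
by apply/eqP => /(congr1 size); rewrite !size_cat /=; lia.
Qed.

Let nth_theta_cat (s t : seq int) z y :
  nth 0%R (s ++ z :: y :: t) (size s) = z /\
  nth 0%R (s ++ z :: y :: t) (size s).+1 = y.
Proof. by rewrite !nth_cat ltnn subnn ltnNge leqnSn subSnn. Qed.

Lemma theta_cat_branch th z l i : `|z|%N = l ->
  branch (size (val th)) l i (theta_cat th z i%:Z).
Proof.
by move=> zl; rewrite /branch /= !(proj1 (nth_theta_cat _ _ _ _))
  (proj2 (nth_theta_cat _ _ _ _)) zl !eqxx.
Qed.

Lemma extensions_branch th z l i : `|z|%N = l ->
  extensions (theta_cat th z i%:Z) `<=` branch (size (val th)) l i.
Proof.
move=> zl nu /andP[/prefixP[t /= nuE] _].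
by rewrite /branch /= nuE -catA /= (proj1 (nth_theta_cat _ _ _ _))
  (proj2 (nth_theta_cat _ _ _ _)) zl !eqxx.
Qed.

Lemma branch_disjoint k l i l' i' : (l, i) != (l', i') ->
  branch k l i `&` branch k l' i' = set0.
Proof.
move=> ne; apply/seteqP; split => // nu.
move=> [/andP[/eqP l1 /eqP i1] /andP[/eqP l2 /eqP i2]].
by move: ne; rewrite -l1 -l2; move: i2; rewrite i1 => -[->]; rewrite eqxx.
Qed.

(** Two indices of the same length are not proper prefixes of each other, so an index
extending both would make them equal. *)
Lemma extensions_disjoint th nu : size (val th) = size (val nu) -> th != nu ->
  extensions th `&` extensions nu = set0.
Proof.
move=> sz ne; apply/seteqP; split => // x [/andP[/prefixP[t e] _]].
move=> /andP[/prefixP[t' e'] _]; move/eqP: ne; apply; apply/val_inj.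
have := congr1 (take (size (val th))) e.
rewrite e' take_size_cat// sz take_size_cat//.
Qed.

Lemma self_extensions_disjoint th nu : size (val th) = size (val nu) ->
  [set th] `&` extensions nu = set0.
Proof.
move=> sz; apply/seteqP; split => // _ [-> /andP[/prefixP[t e] /eqP]]; apply.
rewrite e; have := congr1 size e; rewrite size_cat sz.
by case: t {e} => [|? ?] /=; rewrite ?cats0//; lia.
Qed.

Lemma theta_cat_neq th z z' y : z != z' -> theta_cat th z y != theta_cat th z' y.
Proof.
apply: contraNneq => /(congr1 val) /= /eqP.
by rewrite eqseq_cat// eqxx /= => /eqP[->].
Qed.

End index_groups.

(** * Fields adapted to a group of indices *)

Lemma measurable_sum_seq d (T : measurableType d) (R : realType) (I : eqType)
    (s : seq I) (h : I -> T -> R) :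
  (forall i, i \in s -> measurable_fun setT (h i)) ->
  measurable_fun setT (fun t => \sum_(i <- s) h i t).
Proof.
elim: s => [|i s IH] mh.
  by under eq_fun do rewrite big_nil; exact: measurable_cst.
under eq_fun do rewrite big_cons.
apply: measurable_funD; first by apply: mh; rewrite mem_head.
by apply: IH => j js; apply: mh; rewrite inE js orbT.
Qed.

Section adapted_fields.
Context (R : realType) (dO : measure_display) (Omega : measurableType dO)
  (P : probability Omega R) (F : Theta -> set (set Omega))
  (F_sigma : forall th, sigma_algebra setT (F th))
  (F_sub : forall th, F th `<=` measurable) (F_indep : independent_classes P F).

Local Notation grp I := (g_sigma_algebraType (group_gen F I)).

Lemma group_gen_measurable I : group_gen F I `<=` measurable.
Proof. by move=> A [k _ FA]; exact: F_sub FA. Qed.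

Let sub_grp I (A : set Omega) : <<s group_gen F I >> A -> measurable A.
Proof.
by apply: smallest_sub; [exact: sigma_algebra_measurable|exact: group_gen_measurable].
Qed.

Lemma grp_measurable I d (T : measurableType d) (U : Omega -> T) :
  measurable_fun setT (U : grp I -> T) -> measurable_fun setT U.
Proof.
move=> mU _ B mB; rewrite setTI; apply: (@sub_grp I).
exact: (measurable_preimage mU mB).
Qed.

Lemma grp_sub I J d (T : measurableType d) (U : Omega -> T) : I `<=` J ->
  measurable_fun setT (U : grp I -> T) -> measurable_fun setT (U : grp J -> T).
Proof.
move=> IJ mU _ B mB; rewrite setTI.
have : <<s group_gen F I >> (U @^-1` B) by exact: (measurable_preimage mU mB).
by apply: sub_sigma_algebra2 => A [k Ik FA]; exists k => //; exact: IJ.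
Qed.

Lemma grp_indep I J d1 d2 (T1 : measurableType d1) (T2 : measurableType d2)
    (U : Omega -> T1) (V : Omega -> T2) : I `&` J = set0 ->
  measurable_fun setT (U : grp I -> T1) -> measurable_fun setT (V : grp J -> T2) ->
  indep_maps P U V.
Proof.
move=> IJ mU mV A B mA mB; apply: (group_indep F_sigma F_sub F_indep IJ).
  exact: (measurable_preimage mU mA).
exact: (measurable_preimage mV mB).
Qed.

Section adapted.
Context (dX : measure_display) (X : measurableType dX).

(** Joint measurability in the point and in [om], as opposed to measurability in [om]
at each point, is what allows random points to be substituted for [x]. *)
Definition adapted (I : set Theta) (d : measure_display) (T : measurableType d)
    (f : X -> Omega -> T) : Prop :=
  measurable_fun setT (fun p : X * grp I => f p.1 p.2).

Lemma adapted_sub I J d (T : measurableType d) (f : X -> Omega -> T) :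
  I `<=` J -> adapted I f -> adapted J f.
Proof.
move=> IJ mf.
have mid : measurable_fun setT (id : grp J -> grp I).
  by apply: (@grp_sub I J _ (grp I) id IJ).
apply: (measurableT_comp mf (g := fun p : X * grp J => (p.1, p.2 : grp I))).
apply: measurable_fun_pair => //.
exact: (measurableT_comp mid (measurable_snd (T1 := X) (T2 := grp J))).
Qed.

Lemma adapted_comp I d (T : measurableType d) (f : X -> Omega -> T)
    (Z : X -> Omega -> X) :
  adapted I f -> adapted I Z -> adapted I (fun x om => f (Z x om) om).
Proof.
move=> mf mZ.
apply: (measurableT_comp mf (g := fun p : X * grp I => (Z p.1 p.2, p.2))).
exact: measurable_fun_pair.
Qed.

Lemma adapted_at I d (T : measurableType d) (f : X -> Omega -> T) x :
  adapted I f -> measurable_fun setT (f x : grp I -> T).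
Proof. by move=> mf; exact: (measurable_fun_pair2 x mf). Qed.

Lemma adapted_measurable I d (T : measurableType d) (f : X -> Omega -> T) x :
  adapted I f -> measurable_fun setT (f x).
Proof. by move=> mf; apply: (@grp_measurable I); exact: adapted_at. Qed.

End adapted.
End adapted_fields.

(** * Measurability and law of the multilevel scheme *)

Section scheme.
Context (R : realType) (M : nat) (A : finType) (a0 : A)
  (dO : measure_display) (Omega : measurableType dO) (P : probability Omega R)
  (dX : measure_display) (X : measurableType dX)
  (g : X -> A -> R) (delta : R)
  (F : Theta -> set (set Omega))
  (F_sigma : forall th, sigma_algebra setT (F th))
  (F_sub : forall th, F th `<=` measurable) (F_indep : independent_classes P F)
  (Y : Theta -> X -> A -> Omega -> X)
  (Q : nat -> Theta -> X -> A -> Omega -> R).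

Local Notation grp I := (g_sigma_algebraType (group_gen F I)).

Hypothesis g_meas : forall a, measurable_fun setT (g ^~ a).
Hypothesis Y_adapted : forall th a, adapted F [set th] (fun x om => Y th x a om).

Let Yfield th (om : Omega) : fspace (X * A) X := fun z => Y th z.1 z.2 om.

Hypothesis Y_law : forall th th', eqlaw P (Yfield th) (Yfield th').

(** The recursion uses it for indices [eta] and [eta'] that differ in the sign of the
level. At level zero they coincide, but there the second maximum has weight zero; at
positive levels the two maxima are independent of each other. *)
Definition correction (l : nat) (eta eta' : Theta) (x : X) (om : Omega) : R :=
  fmax a0 (fun b => Q l eta x b om)
  - (0 < l)%N%:R * fmax a0 (fun b => Q l.-1 eta' x b om).

Definition level_term (th : Theta) (p : nat * nat) (om : Omega) (z : X * A) : R :=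
  let eta := theta_cat th p.1%:Z p.2%:Z in
  correction p.1 eta (theta_cat th (- p.1%:Z) p.2%:Z) (Y eta z.1 z.2 om) om.

(** The range of the double sum, flattened so that sums over it can be treated by
induction on a list. *)
Definition levels (n : nat) : seq (nat * nat) :=
  [seq (l, i) | l <- index_iota 0 n, i <- index_iota 1 (M ^ (n - l)).+1].

Hypothesis Q_rec : forall n x a th om, Q n th x a om = g x a +
  \sum_(p <- levels n) delta / (M ^ (n - p.1))%:R * level_term th p om (x, a).

Lemma levels_uniq n : uniq (levels n).
Proof.
apply: allpairs_uniq_dep; first exact: iota_uniq.
  by move=> l _; exact: iota_uniq.
by move=> [l i] [l' i'] _ _ /= [-> ->].
Qed.

Lemma levels_lt n p : p \in levels n -> (p.1 < n)%N.
Proof. by move=> /allpairsPdep[l [i [+ _ ->]]]; rewrite mem_index_iota. Qed.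

Lemma Q0E th x a om : Q 0 th x a om = g x a.
Proof. by rewrite Q_rec /levels /= big_nil addr0. Qed.

Section measurability.

Let Qadapted n := forall th b, adapted F (extensions th) (fun x om => Q n th x b om).

Let correction_adapted_rec l eta eta' : Qadapted l -> Qadapted l.-1 ->
  adapted F (extensions eta `|` extensions eta') (correction l eta eta').
Proof.
move=> Ql Ql1; apply: measurable_funB.
  apply: (measurable_fmax a0 (T := (X * grp _)%type)) => b.
  by apply: (adapted_sub _ (Ql eta b)); left.
apply: measurable_funM => //.
apply: (measurable_fmax a0 (T := (X * grp _)%type)) => b.
by apply: (adapted_sub _ (Ql1 eta' b)); right.
Qed.

Let own (th : Theta) (p : nat * nat) : set Theta :=
  [set theta_cat th p.1%:Z p.2%:Z] `|`
  (extensions (theta_cat th p.1%:Z p.2%:Z) `|`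
   extensions (theta_cat th (- p.1%:Z) p.2%:Z)).

Let level_term_adapted_rec th p a : Qadapted p.1 -> Qadapted p.1.-1 ->
  adapted F (own th p) (fun x om => level_term th p om (x, a)).
Proof.
move=> Ql Ql1.
apply: (adapted_comp
    (f := correction p.1 (theta_cat th p.1%:Z p.2%:Z) (theta_cat th (- p.1%:Z) p.2%:Z))
    (Z := fun x om => Y (theta_cat th p.1%:Z p.2%:Z) x a om)).
  by apply: (adapted_sub _ (@correction_adapted_rec _ _ _ Ql Ql1)); right.
by apply: (adapted_sub _ (@Y_adapted (theta_cat th p.1%:Z p.2%:Z) a)); left.
Qed.

(** The indices of the fields in the recursion for [th] are strict extensions of [th],
and so are the strict extensions of those indices. *)
Lemma Q_adapted n th b :
  adapted F (extensions th) (fun x om => Q n th x b om).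
Proof.
suff : Qadapted n by exact.
elim/ltn_ind: n {th b} => n IH th b.
rewrite (_ : (fun x om => _) = (fun x om => g x b + \sum_(p <- levels n)
  delta / (M ^ (n - p.1))%:R * level_term th p om (x, b))); last first.
  by apply/funext => x; apply/funext => om; rewrite Q_rec.
apply: measurable_funD.
  exact: (measurableT_comp (g_meas b)).
apply: measurable_sum_seq => p /levels_lt pn; apply: measurable_funM => //.
apply: (adapted_sub _ (@level_term_adapted_rec _ _ _ (IH _ pn) (IH _ _))).
  move=> nu [->|[]]; first exact: theta_cat_extensions.
    exact: extensions_theta_cat.
  exact: extensions_theta_cat.
by rewrite (leq_ltn_trans (leq_pred _)).
Qed.

Lemma correction_adapted l eta eta' :
  adapted F (extensions eta `|` extensions eta') (correction l eta eta').
Proof. by apply: correction_adapted_rec => th b; exact: Q_adapted. Qed.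

Lemma level_term_adapted th p a :
  adapted F (branch (size (val th)) p.1 p.2) (fun x om => level_term th p om (x, a)).
Proof.
apply: (adapted_sub _ (@level_term_adapted_rec th p a _ _)); last 2 first.
- by move=> th' b; exact: Q_adapted.
- by move=> th' b; exact: Q_adapted.
move=> nu [->|[]]; first exact: theta_cat_branch.
  exact: extensions_branch.
by apply: extensions_branch; rewrite abszN.
Qed.

End measurability.

Let Qfield n th (om : Omega) : fspace (X * A) R := fun z => Q n th z.1 z.2 om.

Lemma Yfield_measurable th :
  measurable_fun setT (Yfield th : grp [set th] -> fspace (X * A) X).
Proof.
apply: measurable_fspace => -[x a]; exact: (adapted_at x (@Y_adapted th a)).
Qed.

Let Yfield_measurableT th : measurable_fun setT (Yfield th).
Proof. by apply: (grp_measurable F_sub (I := [set th])); exact: Yfield_measurable. Qed.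

Let Qfield_measurable n th :
  measurable_fun setT (Qfield n th : grp (extensions th) -> fspace (X * A) R).
Proof.
apply: measurable_fspace => -[x a]; exact: (adapted_at x (@Q_adapted n th a)).
Qed.

Let Qfield_measurableT n th : measurable_fun setT (Qfield n th).
Proof. by apply: (grp_measurable F_sub); exact: Qfield_measurable. Qed.

Let Yfield_indep th I : [set th] `&` I = set0 ->
  indep_maps P (Yfield th) (id : Omega -> grp I).
Proof.
move=> d; apply: (grp_indep F_sigma F_sub F_indep d) => //.
exact: Yfield_measurable.
Qed.

Let measurable_maxfield d (S : measurableType d) (h : S -> fspace (X * A) R) x :
  measurable_fun setT h ->
  measurable_fun setT (fun t => fmax a0 (fun b => h t (x, b))).
Proof.
move=> mh; apply: (measurable_fmax a0) => b.
exact: (measurableT_comp (measurable_eval (T := R) (x, b)) mh).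
Qed.

(** At level zero both fields are the deterministic [g]. At positive levels the pair of
fields has the product law, and the difference of the maxima is an image of it. *)
Let correction_law l eta eta' nu nu' :
  ((0 < l)%N -> extensions eta `&` extensions eta' = set0) ->
  ((0 < l)%N -> extensions nu `&` extensions nu' = set0) ->
  eqlaw P (Qfield l eta) (Qfield l nu) ->
  eqlaw P (Qfield l.-1 eta') (Qfield l.-1 nu') ->
  @eqlaw _ _ _ P _ (fspace X R) (fun om x => correction l eta eta' x om)
    (fun om x => correction l nu nu' x om).
Proof.
case: l => [_ _ _ _|l dis dis' law law'] B mB; rewrite /correction.
  congr (P (_ @^-1` B)); apply/funext => om; apply/funext => x.
  rewrite /= !mul0r; congr (fmax a0 _ - _); apply/funext => b.
  by rewrite !Q0E.
have lawp := eqlaw_pair (@Qfield_measurableT l.+1 eta) (@Qfield_measurableT l eta')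
  (@Qfield_measurableT l.+1 nu) (@Qfield_measurableT l nu')
  (grp_indep F_sigma F_sub F_indep (dis isT) (@Qfield_measurable _ _)
    (@Qfield_measurable _ _))
  (grp_indep F_sigma F_sub F_indep (dis' isT) (@Qfield_measurable _ _)
    (@Qfield_measurable _ _))
  law law'.
pose h (q : fspace (X * A) R * fspace (X * A) R) : fspace X R :=
  fun x => fmax a0 (fun b => q.1 (x, b)) - 1 * fmax a0 (fun b => q.2 (x, b)).
have mh : measurable_fun setT h.
  apply: measurable_fspace => x; apply: measurable_funB.
    exact: measurable_maxfield.
  apply: measurable_funM => //; exact: measurable_maxfield.
exact: (eqlaw_comp mh lawp mB).
Qed.

Let levelfield th p (om : Omega) : fspace (X * A) R := level_term th p om.

(** The transition depends on [F] at a single index, and the correction on [F] at strict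
extensions of indices of the same length, which are other indices. So the correction
is evaluated at independent points. *)
Let level_law th th' p :
  (forall nu nu', eqlaw P (Qfield p.1 nu) (Qfield p.1 nu')) ->
  (forall nu nu', eqlaw P (Qfield p.1.-1 nu) (Qfield p.1.-1 nu')) ->
  eqlaw P (levelfield th p) (levelfield th' p).
Proof.
move=> law law'.
have dis1 nu : [set theta_cat nu p.1%:Z p.2%:Z] `&`
    (extensions (theta_cat nu p.1%:Z p.2%:Z) `|`
     extensions (theta_cat nu (- p.1%:Z) p.2%:Z)) = set0.
  by rewrite setIUr !self_extensions_disjoint ?setU0// !size_theta_cat.
have dis2 nu : (0 < p.1)%N -> extensions (theta_cat nu p.1%:Z p.2%:Z) `&`
     extensions (theta_cat nu (- p.1%:Z) p.2%:Z) = set0.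
  move=> p0; rewrite extensions_disjoint// ?size_theta_cat//.
  by apply: theta_cat_neq; lia.
pose up nu := theta_cat nu p.1%:Z p.2%:Z; pose down nu := theta_cat nu (- p.1%:Z) p.2%:Z.
have claw : @eqlaw _ _ _ P _ (fspace X R)
    (fun om x => correction p.1 (up th) (down th) x om)
    (fun om x => correction p.1 (up th') (down th') x om).
  exact: correction_law (dis2 th) (dis2 th') (law _ _) (law' _ _).
exact: (eqlaw_random_argument (@group_gen_measurable _ _ _ F_sub _)
  (@group_gen_measurable _ _ _ F_sub _)
  (@Yfield_measurableT (up th)) (@Yfield_measurableT (up th'))
  (@correction_adapted p.1 (up th) (down th))
  (@correction_adapted p.1 (up th') (down th'))
  (Yfield_indep (dis1 th)) (Yfield_indep (dis1 th')) (Y_law _ _) claw).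
Qed.

Let partial_sum (c : nat -> R) (L : seq (nat * nat)) th (om : Omega) :
    fspace (X * A) R :=
  fun z => \sum_(p <- L) c p.1 * level_term th p om z.

Lemma level_sum_measurable (c : nat * nat -> R) (e : nat * nat -> R)
    (L : seq (nat * nat)) th z :
  measurable_fun setT ((fun om => \sum_(p <- L) c p * (level_term th p om z - e p)) :
    grp [set nu | exists2 p, p \in L & branch (size (val th)) p.1 p.2 nu] -> R).
Proof.
apply: measurable_sum_seq => p pL; apply: measurable_funM => //.
apply: measurable_funB => //; case: z => x a.
apply: (grp_sub _ (adapted_at x (@level_term_adapted th p a))).
by move=> nu bnu; exists p.
Qed.

Lemma level_sum_disjoint (L : seq (nat * nat)) p k : p \notin L ->
  branch k p.1 p.2 `&` [set nu | exists2 q, q \in L & branch k q.1 q.2 nu] = set0.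
Proof.
move=> pL; apply/seteqP; split => // nu [bp [q qL bq]].
have pq : (p.1, p.2) != (q.1, q.2).
  by rewrite -!surjective_pairing; apply: contraNneq pL => ->.
have : (branch k p.1 p.2 `&` branch k q.1 q.2) nu by [].
by rewrite branch_disjoint.
Qed.

(** The terms are independent, so they may be added one at a time. *)
Let partial_sum_law c L th th' : uniq L ->
  (forall p, p \in L -> forall nu nu', eqlaw P (levelfield nu p) (levelfield nu' p)) ->
  eqlaw P (partial_sum c L th) (partial_sum c L th').
Proof.
elim: L => [_ _|p L IH /= /andP[pL uL] law] B mB.
  by congr (P (_ @^-1` B)); apply/funext => om; apply/funext => z;
    rewrite /partial_sum !big_nil.
have {}IH : eqlaw P (partial_sum c L th) (partial_sum c L th').
  by apply: IH => // q qL; apply: law; rewrite inE qL orbT.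
have mT (nu : Theta) : measurable_fun setT (levelfield nu p :
    grp (branch (size (val nu)) p.1 p.2) -> fspace (X * A) R).
  apply: measurable_fspace => -[x a].
  exact: (adapted_at x (@level_term_adapted nu p a)).
have mS (nu : Theta) : measurable_fun setT (partial_sum c L nu :
    grp [set eta | exists2 q, q \in L & branch (size (val nu)) q.1 q.2 eta] ->
    fspace (X * A) R).
  apply: measurable_fspace => z.
  apply: (eq_measurable_fun _ _ (@level_sum_measurable (fun q => c q.1) (fun=> 0) L nu z)).
  by move=> om _; rewrite /partial_sum; apply: eq_bigr => q _; rewrite subr0.
have ind (nu : Theta) : indep_maps P (levelfield nu p) (partial_sum c L nu).
  exact: (grp_indep F_sigma F_sub F_indep (level_sum_disjoint (size (val nu)) pL)
    (mT nu) (mS nu)).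
have lawp := eqlaw_pair (grp_measurable F_sub (mT th)) (grp_measurable F_sub (mS th))
  (grp_measurable F_sub (mT th')) (grp_measurable F_sub (mS th'))
  (ind th) (ind th') (law p (mem_head _ _) th th') IH.
pose h (q : fspace (X * A) R * fspace (X * A) R) : fspace (X * A) R :=
  fun z => c p.1 * q.1 z + q.2 z.
have mh : measurable_fun setT h.
  apply: measurable_fspace => z; apply: measurable_funD.
    apply: measurable_funM => //.
    exact: (measurableT_comp (measurable_eval (T := R) z) measurable_fst).
  exact: (measurableT_comp (measurable_eval (T := R) z) measurable_snd).
have := eqlaw_comp mh lawp mB.
congr (P (_ @^-1` B) = P (_ @^-1` B)); apply/funext => om; apply/funext => z;
  by rewrite /partial_sum big_cons.
Qed.

(** The random fields [Q n th] are identically distributed: by strong induction every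
summand of the recursion has a law that does not depend on [th]. *)
Lemma Q_law n th th' : eqlaw P (Qfield n th) (Qfield n th').
Proof.
elim/ltn_ind: n th th' => n IH th th'.
pose c l := delta / (M ^ (n - l))%:R.
have law : eqlaw P (partial_sum c (levels n) th) (partial_sum c (levels n) th').
  apply: partial_sum_law; first exact: levels_uniq.
  move=> p /levels_lt pn nu nu'; apply: level_law => eta eta'; apply: IH => //.
  by rewrite (leq_ltn_trans (leq_pred _)).
pose h (q : fspace (X * A) R) : fspace (X * A) R := fun z => g z.1 z.2 + q z.
have mh : measurable_fun setT h.
  apply: measurable_fspace => z; apply: measurable_funD => //.
  exact: measurable_eval.
move=> B mB; have := eqlaw_comp mh law mB.
congr (P (_ @^-1` B) = P (_ @^-1` B)); apply/funext => om; apply/funext => -[x a];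
  by rewrite /Qfield Q_rec.
Qed.

Definition next_value l (eta nu : Theta) (z : X * A) (om : Omega) : R :=
  fmax a0 (fun b => Q l eta (Y nu z.1 z.2 om) b om).

Lemma max_adapted l eta :
  adapted F (extensions eta) (fun x om => fmax a0 (fun b => Q l eta x b om)).
Proof.
apply: (measurable_fmax a0 (T := (X * grp _)%type)) => b.
exact: Q_adapted.
Qed.

Lemma next_value_measurable l eta nu z : measurable_fun setT (next_value l eta nu z).
Proof.
case: z => x a.
apply: (@grp_measurable _ _ _ F_sub setT).
apply: (adapted_at x (X := X) (f := fun x om => next_value l eta nu (x, a) om)).
apply: (adapted_comp (f := fun x om => fmax a0 (fun b => Q l eta x b om))
  (Z := fun x om => Y nu x a om)).
  exact: (adapted_sub _ (@max_adapted l eta)).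
exact: (adapted_sub _ (@Y_adapted nu a)).
Qed.

Lemma next_value_law l eta nu eta' nu' z :
  [set nu] `&` extensions eta = set0 -> [set nu'] `&` extensions eta' = set0 ->
  eqlaw P (next_value l eta nu z) (next_value l eta' nu' z).
Proof.
move=> dis dis'.
have mh : measurable_fun setT (fun f : fspace (X * A) R =>
    (fun x => fmax a0 (fun b => f (x, b))) : fspace X R).
  apply: measurable_fspace => x.
  exact: (measurable_maxfield (h := id) x (@measurable_id _ _ _)).
have law := eqlaw_comp mh (Q_law l eta eta').
have := @eqlaw_random_argument _ _ _ P (X * A)%type _ X _ R _ _
  (Yfield nu) (Yfield nu') (fun x om => fmax a0 (fun b => Q l eta x b om))
  (fun x om => fmax a0 (fun b => Q l eta' x b om))
  (@group_gen_measurable _ _ _ F_sub _) (@group_gen_measurable _ _ _ F_sub _)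
  (@Yfield_measurableT _) (@Yfield_measurableT _)
  (@max_adapted _ _) (@max_adapted _ _)
  (Yfield_indep dis) (Yfield_indep dis') (Y_law _ _) law.
exact: (eqlaw_comp (measurable_eval (T := R) z)).
Qed.

(** * Error recursion of the multilevel scheme *)

Section error.
Context (w : X -> R) (lambda kap K : R) (Qs : X -> A -> R).
Hypotheses (M_gt0 : (0 < M)%N) (w_gt0 : forall x, 0 < w x)
  (w_meas : measurable_fun setT w) (lambda_gt0 : 0 < lambda) (delta_ge0 : 0 <= delta)
  (kap_gt0 : 0 < kap) (g_bound : forall x b, `|g x b| <= kap * w x)
  (w_growth : forall x a, second_moment_le P (fun om => w (Y theta0 x a om))
     ((lambda * w x) ^+ 2))
  (Qs_meas : forall b, measurable_fun setT (Qs ^~ b))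
  (K_ge0 : 0 <= K) (Qs_bound : forall x b, `|Qs x b| <= K * w x)
  (Qs_eq : forall x a, Qs x a =
     g x a + delta * \int[P]_om fmax a0 (Qs (Y theta0 x a om))).

Definition error_le (n : nat) (e : R) : Prop := forall th x,
  (\int[P]_om (fmax a0 (fun b => `|Qs x b - Q n th x b om| ^+ 2))%:E
     <= ((e * w x) ^+ 2)%:E)%E.

Let Y_measurable th x a : measurable_fun setT (Y th x a).
Proof. exact: (adapted_measurable F_sub x (@Y_adapted th a)). Qed.

Let w_growth_any th x a :
  second_moment_le P (fun om => w (Y th x a om)) ((lambda * w x) ^+ 2).
Proof.
split; first exact: measurableT_comp.
have [_] := w_growth x a; apply: le_trans.
rewrite le_eqVlt; apply/orP; left; apply/eqP.
have law : eqlaw P (Y th x a) (Y theta0 x a).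
  exact: (eqlaw_comp (measurable_eval (T := X) (x, a)) (Y_law th theta0)).
apply: (eqlaw_integral (f := fun y => ((w y) ^+ 2)%:E) _ _ _ law) => //.
exact/measurable_EFinP/measurable_funX.
Qed.

Let optimal_value nu (z : X * A) (om : Omega) : R := fmax a0 (Qs (Y nu z.1 z.2 om)).

Let optimal_value_measurable nu z : measurable_fun setT (optimal_value nu z).
Proof.
apply: (measurable_fmax a0) => b.
exact: (measurableT_comp (Qs_meas b) (@Y_measurable nu z.1 z.2)).
Qed.

Let optimal_second_moment nu x a :
  second_moment_le P (optimal_value nu (x, a)) ((K * (lambda * w x)) ^+ 2).
Proof.
apply: (second_moment_scale K_ge0 _ _ (w_growth_any nu x a)) => //.
move=> om; apply: fmax_norm_le => b.
by rewrite (le_trans (Qs_bound _ _))// ler_wpM2l ?ler_norm.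
Qed.

(** The state reached by [Y nu] is independent of [Q l eta], so it can be frozen: the
error there is at most [e * w] of that state, and [w_growth] integrates this bound.
Maxima over the actions are at most as far apart as the functions. *)
Lemma next_value_error l e eta nu x a : [set nu] `&` extensions eta = set0 ->
  error_le l e -> 0 <= e ->
  second_moment_le P (fun om => next_value l eta nu (x, a) om - optimal_value nu (x, a) om)
    ((e * (lambda * w x)) ^+ 2).
Proof.
move=> dis erl e0.
have mN := next_value_measurable l eta nu (x, a).
split; first exact: measurable_funB.
pose D x' om := fmax a0 (fun b => `|Qs x' b - Q l eta x' b om| ^+ 2).
have mD : adapted F (extensions eta) D.
  apply: (measurable_fmax a0 (T := (X * grp _)%type)) => b.
  apply: measurable_funX; apply: measurableT_comp => //.
  apply: measurable_funB; last exact: Q_adapted.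
  exact: (measurableT_comp (Qs_meas b) measurable_fst).
have D0 x' om : 0 <= D x' om.
  by rewrite (le_trans _ (le_fmax a0 _ a0))// sqr_ge0.
have mY : measurable_fun setT (Y nu x a : grp [set nu] -> X).
  exact: (adapted_at x (@Y_adapted nu a)).
have mid : measurable_fun setT (id : Omega -> grp (extensions eta)).
  by apply: (@grp_measurable _ _ _ F_sub (extensions eta) _ (grp (extensions eta))).
have mDY : measurable_fun setT (fun om => D (Y nu x a om) om).
  exact: (measurableT_comp mD (measurable_fun_pair (Y_measurable _ _ _) mid)).
apply: (@le_trans _ _ (\int[P]_om (D (Y nu x a om) om)%:E)%E).
  apply: ge0_le_integral => //.
  - by move=> om _; rewrite lee_fin sqr_ge0.
  - exact/measurable_EFinP/measurable_funX/measurable_funB.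
  - exact/measurable_EFinP.
  move=> om _; rewrite lee_fin /next_value /optimal_value /=.
  set y := Y nu x a om.
  have [b cE] := fmaxP a0 (fun b => `|Q l eta y b om - Qs y b|).
  have le_c : `|fmax a0 (fun b => Q l eta y b om) - fmax a0 (Qs y)| <=
      `|Q l eta y b om - Qs y b|.
    apply: fmax_dist => b'; rewrite -cE.
    exact: (le_fmax a0 (fun b => `|Q l eta y b om - Qs y b|)).
  rewrite -(real_normK (num_real (_ - _))).
  apply: (@le_trans _ _ (`|Qs y b - Q l eta y b om| ^+ 2)).
    by rewrite ler_sqr ?nnegrE// [leRHS]distrC.
  exact: (le_fmax a0 (fun b => `|Qs y b - Q l eta y b om| ^+ 2)).
have ind : indep_maps P (Y nu x a) (id : Omega -> grp (extensions eta)).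
  exact: (grp_indep F_sigma F_sub F_indep dis mY).
rewrite (integral_indep (f := fun p => (D p.1 p.2)%:E) (Y_measurable nu x a) mid ind);
  [|exact/measurable_EFinP|by move=> p; rewrite lee_fin; exact: D0].
have smw := w_growth_any nu x a.
have iw := integrable_scale (e ^+ 2) (second_moment_integrable_sqr smw).
apply: (@le_trans _ _ (\int[P]_om (e ^+ 2 * w (Y nu x a om) ^+ 2)%:E)%E).
  apply: ge0_le_integral => //.
  - by move=> om _; apply: integral_ge0 => om' _; rewrite lee_fin; exact: D0.
  - have mDD : measurable_fun setT (fun p : Omega * Omega => (D (Y nu x a p.1) p.2)%:E).
      apply/measurable_EFinP.
      apply: (measurableT_comp mD (g := fun p : Omega * Omega =>
        (Y nu x a p.1, p.2 : grp (extensions eta)))).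
      apply: measurable_fun_pair.
        exact: (measurableT_comp (Y_measurable nu x a) measurable_fst).
      exact: (measurableT_comp mid measurable_snd).
    have DD0 (p : Omega * Omega) : (0 <= (D (Y nu x a p.1) p.2)%:E)%E.
      by rewrite lee_fin; exact: D0.
    exact: (measurable_fun_fubini_tonelli_F (m2 := P) _ mDD DD0).
  - exact: (measurable_int _ iw).
  - by move=> om _; rewrite -exprMn; exact: erl.
rewrite integral_RintegralE// lee_fin RintegralZl//; last first.
  exact: second_moment_integrable_sqr smw.
rewrite [leRHS]exprMn ler_wpM2l ?sqr_ge0//.
exact: second_moment_Ex smw.
Qed.

Let next_value_integrable l e eta nu x a : [set nu] `&` extensions eta = set0 ->
  error_le l e -> 0 <= e -> P.-integrable setT (EFin \o next_value l eta nu (x, a)).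
Proof.
move=> dis erl e0.
have i1 := second_moment_integrable (next_value_error x a dis erl e0).
have i2 := second_moment_integrable (optimal_second_moment nu x a).
rewrite (_ : next_value l eta nu (x, a) = fun om =>
  (next_value l eta nu (x, a) om - optimal_value nu (x, a) om)
  + optimal_value nu (x, a) om); last by apply/funext => om; rewrite subrK.
exact: integrable_add.
Qed.

Let up th (p : nat * nat) : Theta := theta_cat th p.1%:Z p.2%:Z.
Let down th (p : nat * nat) : Theta := theta_cat th (- p.1%:Z) p.2%:Z.

Let up_up th p : [set up th p] `&` extensions (up th p) = set0.
Proof. exact: self_extensions_disjoint. Qed.

Let up_down th p : [set up th p] `&` extensions (down th p) = set0.
Proof. by apply: self_extensions_disjoint; rewrite !size_theta_cat. Qed.

Let level_termE th p om z : level_term th p om z =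
  next_value p.1 (up th p) (up th p) z om
  - (0 < p.1)%N%:R * next_value p.1.-1 (down th p) (up th p) z om.
Proof. by []. Qed.

Let level_term_measurable th p z : measurable_fun setT (fun om => level_term th p om z).
Proof.
apply: measurable_funB; first exact: next_value_measurable.
apply: measurable_funM => //; exact: next_value_measurable.
Qed.

Section step.
Variables (e : nat -> R) (n : nat).
Hypotheses (e_gt0 : forall l, 0 < e l) (e_err : forall l, (l < n)%N -> error_le l (e l)).

(** Level zero involves [g] alone, and the other levels the difference of two
approximations of the same solution. *)
Definition level_bound (l : nat) : R := if l == 0 then kap else e l + e l.-1.

Lemma level_bound_gt0 l : 0 < level_bound l.
Proof. by rewrite /level_bound; case: eqP => // _; rewrite addr_gt0. Qed.

Let level_second_moment th p x a : (p.1 < n)%N ->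
  second_moment_le P (fun om => level_term th p om (x, a))
    ((level_bound p.1 * (lambda * w x)) ^+ 2).
Proof.
move=> pn; have lw0 : 0 < lambda * w x by rewrite mulr_gt0.
rewrite /level_bound; case: eqP => [p0|/eqP p0].
  apply: (second_moment_scale (ltW kap_gt0) _ _ (w_growth_any (up th p) x a)) => //.
  move=> om; rewrite level_termE p0 mul0r subr0; apply: fmax_norm_le => b.
  by rewrite Q0E (le_trans (g_bound _ _))// ler_wpM2l ?ler_norm ?ltW.
have p0' : (0 < p.1)%N by rewrite lt0n.
have sm1 := next_value_error x a (up_up th p) (e_err pn) (ltW (e_gt0 _)).
have sm2 := next_value_error x a (up_down th p)
  (e_err (leq_ltn_trans (leq_pred _) pn)) (ltW (e_gt0 _)).
rewrite mulrDl; apply: (second_moment_add _ _ _ _ sm1 sm2) => //.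
- exact: mulr_gt0.
- exact: mulr_gt0.
move=> om; rewrite level_termE p0' mul1r.
rewrite (_ : _ - _ = (next_value p.1 (up th p) (up th p) (x, a) om
  - optimal_value (up th p) (x, a) om) -
  (next_value p.1.-1 (down th p) (up th p) (x, a) om
  - optimal_value (up th p) (x, a) om)); last by ring.
exact: ler_normB.
Qed.

Let th1 : Theta := exist _ [:: 1 : int] isT.

Let mean l z := \int[P]_om next_value l th1 theta0 z om.

Let th01 : [set theta0] `&` extensions th1 = set0.
Proof. exact: self_extensions_disjoint. Qed.

(** When the transition is independent of the approximation, the expectation of the next
value depends on neither index, by [next_value_law]. One representative, [mean], is
used for all of them, which lets the levels telescope. *)
Let mean_level th p x a : (p.1 < n)%N ->
  \int[P]_om level_term th p om (x, a) =
  mean p.1 (x, a) - (0 < p.1)%N%:R * mean p.1.-1 (x, a).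
Proof.
move=> pn; have pn' := leq_ltn_trans (leq_pred _) pn.
have i1 := next_value_integrable x a (up_up th p) (e_err pn) (ltW (e_gt0 _)).
have i2 := next_value_integrable x a (up_down th p) (e_err pn') (ltW (e_gt0 _)).
under eq_Rintegral do rewrite level_termE.
rewrite RintegralB//; last exact: integrable_scale.
rewrite RintegralZl//; congr (_ - _ * _).
  apply: eqlaw_Rintegral; [exact: next_value_measurable..|].
  exact: next_value_law.
apply: eqlaw_Rintegral; [exact: next_value_measurable..|].
exact: next_value_law.
Qed.

Let mean_telescope z : (0 < n)%N ->
  \sum_(p <- levels n) delta / (M ^ (n - p.1))%:R *
    (mean p.1 z - (0 < p.1)%N%:R * mean p.1.-1 z) = delta * mean n.-1 z.
Proof.
move=> n0; rewrite /levels big_allpairs_dep /=.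
transitivity (\sum_(0 <= l < n) delta * (mean l z - (0 < l)%N%:R * mean l.-1 z)).
  apply: eq_bigr => l _; rewrite big_const_seq count_predT size_iota subn1 /=.
  rewrite iter_addr_0 -mulr_natr; field.
  by rewrite pnatr_eq0 expn_eq0 negb_and -lt0n M_gt0.
rewrite -mulr_sumr; congr (_ * _).
case: n n0 => // m _; elim: m => [|m IH].
  by rewrite big_nat1 mul0r subr0.
by rewrite big_nat_recr//= IH mul1r addrC subrK.
Qed.

Let centred th p z (om : Omega) : R :=
  level_term th p om z - \int[P]_om level_term th p om z.

(** The variance of a sum of independent terms, one term at a time. *)
Let fluctuation th x a (c : nat * nat -> R) (L : seq (nat * nat)) : uniq L ->
  (forall p, p \in L -> (p.1 < n)%N) ->
  second_moment_le P (fun om => \sum_(p <- L) c p * centred th p (x, a) om)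
    (\sum_(p <- L) c p ^+ 2 * (level_bound p.1 * (lambda * w x)) ^+ 2).
Proof.
elim: L => [_ _|p L IH /= /andP[pL uL] Ln].
  rewrite big_nil; split; first by under eq_fun do rewrite big_nil; exact: measurable_cst.
  by under eq_integral do rewrite big_nil expr0n /=; rewrite integral0.
have {}IH : second_moment_le P (fun om => \sum_(p <- L) c p * centred th p (x, a) om)
    (\sum_(p <- L) c p ^+ 2 * (level_bound p.1 * (lambda * w x)) ^+ 2).
  by apply: IH => // q qL; apply: Ln; rewrite inE qL orbT.
have pn : (p.1 < n)%N by apply: Ln; rewrite mem_head.
rewrite (_ : (fun om => _) = (fun om => \sum_(p <- L) c p * centred th p (x, a) om
  + c p * centred th p (x, a) om)); last first.
  by apply/funext => om; rewrite big_cons addrC.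
rewrite big_cons addrC.
apply: second_moment_indep IH (level_second_moment th x a pn).
have dis := level_sum_disjoint (size (val th)) pL.
rewrite setIC in dis.
apply: (grp_indep F_sigma F_sub F_indep dis).
  exact: level_sum_measurable.
exact: (adapted_at x (@level_term_adapted th p a)).
Qed.

Let r : R := (Num.sqrt M%:R)^-1.

(** The error is a bias, equal to the error of [Q n.-1] propagated through one step of
the Bellman equation, plus a centred sum of independent terms. If [delta = 0] both
vanish; this case is separate because [fmax_second_moment] needs positive bounds. *)
Lemma error_step : (0 < n)%N ->
  error_le n (delta * lambda * (e n.-1 +
    #|A|%:R * \sum_(0 <= l < n) r ^+ (n - l) * level_bound l)).
Proof.
move=> n0 th x.
have MR0 : 0 < M%:R :> R by rewrite ltr0n.
have r0 : 0 < r by rewrite invr_gt0 sqrtr_gt0.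
have r2 : r ^+ 2 = M%:R^-1 by rewrite exprVn sqr_sqrtr// ltW.
have [d0|dn0] := eqVneq delta 0.
  rewrite (_ : (fun om => _) = cst 0%E); last first.
    apply/funext => om /=; congr EFin; apply/le_anti/andP; split.
      apply: fmax_le => b.
      rewrite Qs_eq Q_rec d0 big1 => [|p _]; last by rewrite !mul0r.
      by rewrite mul0r subrr normr0 expr0n.
    by rewrite (le_trans _ (le_fmax a0 _ a0))// sqr_ge0.
  by rewrite integral0 lee_fin sqr_ge0.
have d0 : 0 < delta by rewrite lt_def dn0.
set S := \sum_(0 <= l < n) _.
have S0 : 0 < S.
  rewrite /S big_ltn// ltr_wpDr//.
    by apply: sumr_ge0 => l _; rewrite mulr_ge0// ?exprn_ge0 ?ltW ?level_bound_gt0.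
  by rewrite mulr_gt0 ?exprn_gt0 ?level_bound_gt0.
pose be := delta * lambda * e n.-1 * w x.
pose si := delta * lambda * w x * S.
have be0 : 0 < be by rewrite !mulr_gt0.
have si0 : 0 < si by rewrite !mulr_gt0.
pose c (p : nat * nat) := delta / (M ^ (n - p.1))%:R.
pose b a := g x a + delta * mean n.-1 (x, a) - Qs x a.
pose Z a om := \sum_(p <- levels n) c p * centred th p (x, a) om.
(* bias plus fluctuation; the means of the levels telescope *)
have QZ a om : Q n th x a om - Qs x a = b a + Z a om.
  have cE : \sum_(p <- levels n) c p * (\int[P]_om' level_term th p om' (x, a)) =
      delta * mean n.-1 (x, a).
    rewrite -mean_telescope//; apply: eq_big_seq => p /levels_lt pn.
    by rewrite mean_level.
  have ZE : Z a om = \sum_(p <- levels n) c p * level_term th p om (x, a) -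
      \sum_(p <- levels n) c p * (\int[P]_om' level_term th p om' (x, a)).
    by rewrite /Z -sumrB; apply: eq_bigr => p _; rewrite /centred mulrBr.
  by rewrite ZE Q_rec /b -cE /c; ring.
have bbe a : `|b a| <= be.
  have pn : (n.-1 < n)%N by rewrite prednK.
  have sm := next_value_error x a th01 (e_err pn) (ltW (e_gt0 _)).
  have i1 := next_value_integrable x a th01 (e_err pn) (ltW (e_gt0 _)).
  have i2 := second_moment_integrable (optimal_second_moment theta0 x a).
  have ew0 : 0 < e n.-1 * (lambda * w x) by rewrite !mulr_gt0.
  have := second_moment_mean ew0 sm; rewrite RintegralB// => le_m.
  rewrite /b Qs_eq opprD addrACA subrr add0r -mulrBr normrM gtr0_norm// /be.
  by rewrite -!mulrA ler_pM2l// mulrCA.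
have smZ a : second_moment_le P (Z a) (si ^+ 2).
  have [mZ Zle] := fluctuation th x a c (levels_uniq n) (@levels_lt n).
  split => //; apply: (le_trans Zle); rewrite lee_fin.
  rewrite /levels big_allpairs_dep /c /=.
  apply: (@le_trans _ _ (\sum_(0 <= l < n)
      (delta * lambda * w x * (r ^+ (n - l) * level_bound l)) ^+ 2)).
    apply: ler_sum => l _; rewrite big_const_seq count_predT size_iota subn1 /=.
    rewrite iter_addr_0 -[leLHS]mulr_natr natrX.
    rewrite (_ : (_ * (r ^+ _ * _)) ^+ 2 = (r ^+ 2) ^+ (n - l) *
      (delta * lambda * w x * level_bound l) ^+ 2); last first.
      by rewrite -exprM mulnC exprM; ring.
    rewrite r2 exprVn.
    have Mn0 : M%:R ^+ (n - l) != 0 :> R by rewrite expf_neq0// gt_eqF.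
    rewrite le_eqVlt; apply/orP; left; apply/eqP.
    by move: (M%:R ^+ (n - l)) (level_bound l) Mn0 => m t m0; field.
  (* the weights give back the l2 norm of the levels, bounded by the l1 norm *)
  apply: le_trans (sum_sqr_le _ _) _.
    move=> l; rewrite mulr_ge0//; first by rewrite !mulr_ge0// ltW.
    by rewrite mulr_ge0// ?exprn_ge0 ?ltW ?level_bound_gt0.
  by rewrite -mulr_sumr.
have := fmax_second_moment a0 be0 si0 bbe smZ.
rewrite (_ : be + _ = delta * lambda * (e n.-1 + #|A|%:R * S) * w x); last first.
  by rewrite /be /si; ring.
apply: le_trans; rewrite le_eqVlt; apply/orP; left; apply/eqP.
apply: eq_integral => om _; congr (fmax a0 _)%:E; apply/funext => a.
by rewrite -QZ distrC.
Qed.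

End step.

(** A geometric sequence that dominates the recursion of [error_step] dominates the
errors; at [n = 0] the error is that of approximating the solution by [g]. *)
Lemma error_geometric (B q : R) : 0 < B -> 0 < q -> kap + K <= B ->
  (forall n, (0 < n)%N -> delta * lambda * (B * q ^+ n.-1 + #|A|%:R *
     \sum_(0 <= l < n) (Num.sqrt M%:R)^-1 ^+ (n - l) *
        level_bound (fun l => B * q ^+ l) l) <= B * q ^+ n) ->
  forall n, error_le n (B * q ^+ n).
Proof.
move=> B0 q0 kKB rec; elim/ltn_ind => n IH.
have e0 l : 0 < B * q ^+ l by rewrite mulr_gt0 ?exprn_gt0.
have [->|n0] := posnP n.
  move=> th x; rewrite expr0 mulr1.
  have bw b : `|Qs x b - g x b| <= B * w x.
    rewrite (le_trans (ler_normB _ _))// (le_trans (lerD (Qs_bound x b) (g_bound x b)))//.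
    by rewrite -mulrDl ler_pM2r// addrC.
  apply: (@le_trans _ _ (\int[P]_om ((B * w x) ^+ 2)%:E)%E).
    apply: ge0_le_integral => //.
    - by move=> om _; rewrite lee_fin (le_trans _ (le_fmax a0 _ a0))// sqr_ge0.
    - apply/measurable_EFinP; apply: (measurable_fmax a0) => b.
      by under eq_fun do rewrite Q0E; exact: measurable_cst.
    move=> om _; rewrite lee_fin; apply: fmax_le => b.
    by rewrite Q0E ler_sqr ?nnegrE// mulr_ge0 ?ltW.
  rewrite integral_RintegralE; last exact: probability_integrable_cst.
  by rewrite Rintegral_probability_cst.
move=> th x; apply: le_trans (error_step e0 IH n0 th x) _.
have wx0 := w_gt0 x.
rewrite lee_fin ler_sqr ?nnegrE.
- by rewrite ler_pM2r//; exact: rec.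
- rewrite mulr_ge0 ?(ltW wx0)// mulr_ge0 ?mulr_ge0 ?(ltW lambda_gt0)//.
  rewrite addr_ge0 ?(ltW (e0 _))// mulr_ge0// sumr_ge0// => l _.
  by rewrite mulr_ge0 ?(ltW (level_bound_gt0 e0 l))// exprn_ge0// invr_ge0 sqrtr_ge0.
- by rewrite mulr_ge0 ?(ltW wx0)// ltW.
Qed.

End error.
End scheme.

(** * The Bellman equation *)

Lemma measurable_discrete_sections (R : realType) (A : finType) (a0 : A)
    (dX : measure_display) (X : measurableType dX) (f : X -> A -> R) :
  measurable_fun [set: X * discrete_copy a0] (fun p : X * discrete_copy a0 => f p.1 p.2)
  <-> forall a, measurable_fun setT (f ^~ a).
Proof.
split=> [mf a|mf].
  apply: (measurableT_comp mf (g := fun x => (x, a : discrete_copy a0))).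
  exact: measurable_fun_pair.
move=> _ B mB; rewrite setTI.
rewrite (_ : _ @^-1` B = \bigcup_(a in [set: A])
    ((f ^~ a @^-1` B) `*` [set (a : discrete_copy a0)])).
  apply: fin_bigcup_measurable => // a _.
  apply: measurableX => //; exact: measurable_preimage.
apply/seteqP; split => [[x a] /= fB|[x a] [b _ [/= fB ab]]] /=.
  by exists a.
by rewrite ab.
Qed.

Lemma expr_lt_eps (R : realType) (q eps : R) : 0 <= q < 1 -> 0 < eps ->
  exists n, q ^+ n < eps.
Proof.
move=> /andP[q0 q1] eps0.
have qn1 : `|q| < 1 by rewrite ger0_norm.
have [n _ /(_ n (leqnn n))] := cvgr0_norm_lt _ (cvg_expr qn1) _ eps0.
by rewrite /= ger0_norm ?exprn_ge0//; exists n.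
Qed.

Section weighted_bounds.
Context (R : realType) (A : finType) (a0 : A) (dX : measure_display)
  (X : measurableType dX) (w : X -> R).
Hypothesis w_gt0 : forall x, 0 < w x.
Implicit Types (f : X -> A -> R) (K : R).

Definition weighted_le f K : Prop := forall x b, `|f x b| <= K * w x.

Lemma weighted_le_ge0 f K : weighted_le f K -> 0 <= K.
Proof.
by move=> /(_ point a0) /(le_trans (normr_ge0 _)); rewrite pmulr_lge0.
Qed.

(** The weighted supremum norm is itself a bound. *)
Lemma weighted_least f K : weighted_le f K -> exists2 K0, weighted_le f K0 &
  forall K', weighted_le f K' -> K0 <= K'.
Proof.
move=> fK; pose E := [set v | exists x b, v = `|f x b| / w x].
have EK K' : weighted_le f K' -> ubound E K'.
  by move=> fK' _ [x [b ->]]; rewrite ler_pdivrMr.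
exists (sup E) => [x b|K' /EK]; last first.
  by apply: ge_sup; exists (`|f point a0| / w point), point, a0.
rewrite -ler_pdivrMr//; apply: ub_le_sup; first by exists K; exact: EK.
by exists x, b.
Qed.

(** The least bound [K0] satisfies [K0 <= u + rho * K0]. This serves for the a priori
bound on solutions, and with [u = 0] for uniqueness. *)
Lemma weighted_contract f K (u rho : R) : weighted_le f K -> rho < 1 ->
  (forall K', weighted_le f K' -> weighted_le f (u + rho * K')) ->
  weighted_le f (u / (1 - rho)).
Proof.
move=> fK rho1 fS; have [K0 fK0 K0min] := weighted_least fK.
move=> x b; rewrite (le_trans (fK0 x b))// ler_pM2r// ler_pdivlMr ?subr_gt0//.
by rewrite mulrBr mulr1 lerBlDr [K0 * _]mulrC; exact/K0min/fS.
Qed.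

End weighted_bounds.

Section bellman.
Context (R : realType) (A : finType) (a0 : A) (dO : measure_display)
  (Omega : measurableType dO) (P : probability Omega R)
  (dX : measure_display) (X : measurableType dX)
  (w : X -> R) (g : X -> A -> R) (delta lambda kap : R) (Y : X -> A -> Omega -> X).
Hypotheses (w_gt0 : forall x, 0 < w x) (w_meas : measurable_fun setT w)
  (lambda_gt0 : 0 < lambda) (delta_ge0 : 0 <= delta)
  (rho_lt1 : delta * lambda < 1)
  (g_meas : forall a, measurable_fun setT (g ^~ a))
  (g_bound : weighted_le w g kap)
  (Y_meas : forall a, measurable_fun setT (fun p : X * Omega => Y p.1 a p.2))
  (w_growth : forall x a,
     second_moment_le P (fun om => w (Y x a om)) ((lambda * w x) ^+ 2)).
Implicit Types (q : X -> A -> R).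

Local Notation rho := (delta * lambda).

Definition section_measurable q : Prop := forall a, measurable_fun setT (q ^~ a).

Definition bellman_op q (x : X) (a : A) : R :=
  g x a + delta * \int[P]_om fmax a0 (q (Y x a om)).

Let rho_ge0 : 0 <= rho. Proof. by rewrite mulr_ge0// ltW. Qed.

Let Yx_meas x a : measurable_fun setT (Y x a).
Proof. exact: (measurable_fun_pair2 x (Y_meas a)). Qed.

Let max_meas q x a : section_measurable q ->
  measurable_fun setT (fun om => fmax a0 (q (Y x a om))).
Proof.
move=> mq; apply: (measurable_fmax a0) => b.
exact: (measurableT_comp (mq b) (@Yx_meas x a)).
Qed.

Let max_integrable q K x a : section_measurable q -> weighted_le w q K ->
  P.-integrable setT (EFin \o (fun om => fmax a0 (q (Y x a om)))).
Proof.
move=> mq qK.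
have iw := second_moment_integrable (w_growth x a).
apply: (dom_integrable _ _ (integrable_scale K iw)); first exact: max_meas.
by move=> om; apply: fmax_norm_le => b; exact: qK.
Qed.

(** The second moment bound on [w] controls its mean, which is what contraction of the
weighted norm requires. *)
Let Ex_dist q q' K x a : section_measurable q -> section_measurable q' ->
  (exists K', weighted_le w q K') -> (exists K', weighted_le w q' K') ->
  weighted_le w (fun x b => q x b - q' x b) K ->
  `|\int[P]_om fmax a0 (q (Y x a om)) - \int[P]_om fmax a0 (q' (Y x a om))|
    <= K * (lambda * w x).
Proof.
move=> mq mq' [Kq qK] [Kq' qK'] qqK.
have iq := max_integrable x a mq qK; have iq' := max_integrable x a mq' qK'.
rewrite -RintegralB//.
have K0 := weighted_le_ge0 a0 w_gt0 qqK.
have iw := second_moment_integrable (w_growth x a).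
have id : P.-integrable setT (EFin \o (fun om =>
    fmax a0 (q (Y x a om)) - fmax a0 (q' (Y x a om)))).
  exact: (integrableB measurableT iq iq').
apply: (le_trans (le_normr_Rintegral measurableT id)).
apply: (@le_trans _ _ (\int[P]_om (K * w (Y x a om)))).
  apply: le_Rintegral => //.
  - exact: (integrable_abse id).
  - exact: integrable_scale.
  - by move=> om _; apply: fmax_dist => b; exact: qqK.
rewrite RintegralZl// ler_wpM2l//.
apply: le_trans (ler_norm _) _; apply: second_moment_mean (w_growth x a).
exact: mulr_gt0.
Qed.

Let bellman_dist q q' K : section_measurable q -> section_measurable q' ->
  (exists K', weighted_le w q K') -> (exists K', weighted_le w q' K') ->
  weighted_le w (fun x b => q x b - q' x b) K ->
  weighted_le w (fun x b => bellman_op q x b - bellman_op q' x b) (rho * K).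
Proof.
move=> mq mq' bq bq' qqK x a; rewrite /bellman_op opprD addrACA subrr add0r.
rewrite -mulrBr normrM ger0_norm// -!mulrA ler_wpM2l//.
by rewrite (le_trans (Ex_dist x a mq mq' bq bq' qqK))// mulrCA.
Qed.

Let bellman_bound q K : section_measurable q -> weighted_le w q K ->
  weighted_le w (bellman_op q) (kap + rho * K).
Proof.
move=> mq qK x a; rewrite /bellman_op mulrDl (le_trans (ler_normD _ _))//.
apply: lerD => //.
pose z0 : X -> A -> R := fun _ _ => 0.
have m0 : section_measurable z0 by move=> b; exact: measurable_cst.
have b0 : weighted_le w z0 0 by move=> y b; rewrite normr0 mul0r.
have := @Ex_dist q z0 K x a mq m0 (ex_intro _ _ qK) (ex_intro _ _ b0).
have f0 om : fmax a0 (z0 (Y x a om)) = 0.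
  by have [b ->] := fmaxP a0 (z0 (Y x a om)).
under [X in _ - X]eq_Rintegral do rewrite f0.
rewrite Rintegral_probability_cst subr0 => /(_ _) le1.
rewrite normrM ger0_norm// -!mulrA ler_wpM2l// mulrCA; apply: le1 => y b.
by rewrite subr0; exact: qK.
Qed.

Let bellman_meas q K : section_measurable q -> weighted_le w q K ->
  section_measurable (bellman_op q).
Proof.
move=> mq qK a; apply: measurable_funD => //; apply: measurable_funM => //.
pose f (p : X * Omega) := (fmax a0 (q (Y p.1 a p.2)))%:E.
have mf : measurable_fun setT f.
  apply/measurable_EFinP; apply: (measurable_fmax a0) => b.
  exact: (measurableT_comp (mq b) (Y_meas a)).
have mI : measurable_fun setT (fun x => \int[P]_om f (x, om))%E.
  rewrite (_ : (fun x => _) = fun x =>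
    (\int[P]_om f^\+ (x, om) - \int[P]_om f^\- (x, om))%E).
    apply: emeasurable_funB.
      exact: (measurable_fun_fubini_tonelli_F (m2 := P) _
        (measurable_funepos mf) (fun _ => funepos_ge0 _ _)).
    exact: (measurable_fun_fubini_tonelli_F (m2 := P) _
        (measurable_funeneg mf) (fun _ => funeneg_ge0 _ _)).
  apply/funext => x; rewrite integralE.
  by rewrite (funepos_comp f (fun om => (x, om))) (funeneg_comp f (fun om => (x, om))).
exact: (measurableT_comp (fine_measurable measurableT) mI).
Qed.

Definition picard (k : nat) : X -> A -> R := iter k bellman_op (fun _ _ => 0).

(** The radius of a ball that the Bellman operator maps to itself. *)
Let Kp := kap / (1 - rho).

Let KpE : kap + rho * Kp = Kp.
Proof. by rewrite /Kp; field; rewrite gt_eqF// subr_gt0. Qed.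

Let picard_invariant k : section_measurable (picard k) /\ weighted_le w (picard k) Kp.
Proof.
have kap0 := weighted_le_ge0 a0 w_gt0 g_bound.
elim: k => [|k [mk bk]].
  split; first by move=> b; exact: measurable_cst.
  move=> x b; rewrite normr0; apply: mulr_ge0; last exact: ltW.
  by rewrite /Kp divr_ge0// subr_ge0 ltW.
split; first exact: bellman_meas bk.
by rewrite -KpE; exact: bellman_bound.
Qed.

Let picard_meas k := (picard_invariant k).1.
Let picard_bound k := (picard_invariant k).2.

(** The contraction applied [k] times to [picard j - 0]. *)
Let picard_dist k j :
  weighted_le w (fun x b => picard (k + j) x b - picard k x b) (rho ^+ k * Kp).
Proof.
elim: k => [|k IH].
  by move=> x b; rewrite subr0 expr0 mul1r; exact: picard_bound.
rewrite exprS -mulrA addSn; apply: bellman_dist IH => //.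
- by exists Kp.
- by exists Kp.
Qed.

Let picard_cvg x a : cvgn (fun k => picard k x a).
Proof.
have rho1 : `|rho| < 1 by rewrite ger0_norm.
suff : cvgn (series (telescope (fun k => picard k x a))).
  rewrite telescopeK => cv.
  rewrite (_ : (fun k => _) = (fun k => (picard k x a - picard 0 x a) + picard 0 x a)).
    by apply: is_cvgD => //; exact: is_cvg_cst.
  by apply/funext => k; rewrite subrK.
apply: normed_cvg.
apply: (@series_le_cvg _ _ (geometric (Kp * w x) rho)) => [k|k|k|].
- exact: normr_ge0.
- by rewrite /= mulr_ge0 ?exprn_ge0// (le_trans _ (picard_bound 0 x a)).
- have := picard_dist k 1 x a; rewrite addn1 => h; apply: le_trans h _.
  by rewrite /= -mulrA mulrC.
- exact: is_cvg_geometric_series.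
Qed.

Definition bellman_fixpoint (x : X) (a : A) : R := limn (fun k => picard k x a).

Let fixpoint_dist k :
  weighted_le w (fun x b => bellman_fixpoint x b - picard k x b) (rho ^+ k * Kp).
Proof.
move=> x a.
have cv : (fun j => `|picard (k + j) x a - picard k x a|) @ \oo -->
    `|bellman_fixpoint x a - picard k x a|.
  apply: cvg_norm; apply: cvgB; last exact: cvg_cst.
  under eq_fun do rewrite addnC.
  have : (fun j => picard j x a) @ \oo --> bellman_fixpoint x a by exact: picard_cvg.
  by rewrite -(cvg_shiftn k).
rewrite -(cvg_lim _ cv)//; apply: limr_le; first by apply/cvg_ex; eexists; exact: cv.
by apply: nearW => j; exact: picard_dist.
Qed.

Lemma bellman_fixpoint_meas : section_measurable bellman_fixpoint.
Proof.
move=> a; apply: (measurable_fun_cvg (h := fun k x => picard k x a)).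
  by move=> k; exact: picard_meas.
by move=> x _; exact: picard_cvg.
Qed.

Lemma bellman_fixpoint_bound : weighted_le w bellman_fixpoint Kp.
Proof.
by move=> x a; have := fixpoint_dist 0 x a; rewrite subr0 expr0 mul1r.
Qed.

(** For every [k] the defect is at most twice [rho ^ k * Kp * w], through the iterate of
rank [k + 1]. *)
Lemma bellman_fixpointE x a : bellman_fixpoint x a = bellman_op bellman_fixpoint x a.
Proof.
apply/eqP; rewrite -subr_eq0 -normr_le0 leNgt; apply/negP => d0.
have Kw0 : 0 <= Kp * w x by exact: le_trans (bellman_fixpoint_bound x a).
have c0 : 0 < 2 * (Kp * w x) + 1 by rewrite ltr_wpDl// mulr_ge0.
have rho01 : 0 <= rho < 1 by rewrite rho_ge0.
have [k] := expr_lt_eps rho01 (divr_gt0 d0 c0); rewrite ltNge => /negP; apply.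
rewrite ler_pdivrMr//.
have h1 := fixpoint_dist k.+1 x a.
have h2 : weighted_le w (fun x b => picard k.+1 x b - bellman_op bellman_fixpoint x b)
    (rho * (rho ^+ k * Kp)).
  apply: bellman_dist; first exact: picard_meas.
  - exact: bellman_fixpoint_meas.
  - by exists Kp; exact: picard_bound.
  - by exists Kp; exact: bellman_fixpoint_bound.
  - by move=> y b; rewrite distrC; exact: fixpoint_dist.
have {}h2 := h2 x a.
rewrite -(subrK (picard k.+1 x a) (bellman_fixpoint x a)) -addrA.
rewrite (le_trans (ler_normD _ _))// (le_trans (lerD h1 h2))//.
have rk0 : 0 <= rho ^+ k by rewrite exprn_ge0.
have h3 : rho * (rho ^+ k * (Kp * w x)) <= rho ^+ k * (Kp * w x).
  by apply: ler_piMl; [exact: mulr_ge0|exact: ltW].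
rewrite [leLHS](_ : _ = 2 * (rho * (rho ^+ k * (Kp * w x)))); last first.
  by rewrite exprS; ring.
by rewrite mulrDr mulr1 mulrCA; lra.
Qed.

Lemma fixed_bound q K : section_measurable q -> weighted_le w q K ->
  (forall x a, q x a = bellman_op q x a) -> weighted_le w q Kp.
Proof.
move=> mq qK qE; apply: (weighted_contract a0 w_gt0 qK rho_lt1) => K' qK' x a.
by rewrite qE; exact: bellman_bound.
Qed.

Lemma fixed_unique q q' K K' : section_measurable q -> section_measurable q' ->
  weighted_le w q K -> weighted_le w q' K' ->
  (forall x a, q x a = bellman_op q x a) -> (forall x a, q' x a = bellman_op q' x a) ->
  forall x a, q x a = q' x a.
Proof.
move=> mq mq' qK qK' qE qE' x a.
have d0 : weighted_le w (fun x b => q x b - q' x b) (K + K').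
  move=> y b; rewrite mulrDl (le_trans (ler_normB _ _))// lerD//.
have := weighted_contract (u := 0) a0 w_gt0 d0 rho_lt1.
have dS K0 : weighted_le w (fun x b => q x b - q' x b) K0 ->
    weighted_le w (fun x b => q x b - q' x b) (0 + rho * K0).
  move=> dK y b; rewrite add0r qE qE'; apply: bellman_dist dK y b => //.
  - by exists K.
  - by exists K'.
move=> /(_ dS x a); rewrite mul0r mul0r normr_le0 subr_eq0.
by move=> /eqP.
Qed.

(** In terms of real numbers: the weighted supremum is finite if and only if some bound
[K * w] holds, and then the expectation in the Bellman equation is finite. *)
Lemma bellman_solutionP q : bellman_solution P a0 w g delta Y q <->
  [/\ section_measurable q, exists K, weighted_le w q K &
      forall x a, q x a = bellman_op q x a].
Proof.
split.
  move=> [mq solq]; have {}mq : section_measurable q.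
    by apply/(measurable_discrete_sections a0).
  have bq : exists K, weighted_le w q K.
    have [+ _ _] := solq point a0; set S := ereal_sup _ => S_fin.
    have Sx x : ((fmax a0 (fun b => `|q x b|) / w x)%:E <= S)%E.
      by apply: ereal_sup_ubound; exists x.
    have SE : S = (fine S)%:E.
      rewrite fineK// fin_numElt S_fin andbT (lt_le_trans _ (Sx point))//.
      exact: ltNyr.
    exists (fine S) => x b; have := Sx x; rewrite SE lee_fin ler_pdivrMr//.
    by apply: le_trans; exact: (le_fmax a0 (fun b => `|q x b|)).
  split => // x a; have [_ _] := solq x a.
  case: bq => K qK; rewrite unlock integral_RintegralE; last exact: max_integrable qK.
  by move=> [].
move=> [mq [K qK] qE]; split; first exact/measurable_discrete_sections.
move=> x a; have imax := max_integrable x a mq qK; split.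
- apply: (@le_lt_trans _ _ K%:E); last exact: ltry.
  apply: ge_ereal_sup => _ [y _ <-]; rewrite lee_fin ler_pdivrMr//.
  by apply: fmax_le => b; exact: qK.
- by rewrite unlock; have /integrableP[_] := imax.
- by rewrite unlock integral_RintegralE// qE.
Qed.

End bellman.

(** * Rates and complexity *)

(** After division by [M ^ n] the recursion is bounded through
[1 + 4 ^ l + 4 ^ (l - 1) <= 3 * 4 ^ l], and [3 * 4 ^ l] sums up to less than [4 ^ n]. *)
Lemma complexity_bound (R : realType) (M : nat) (Rc : R) (C : nat -> R) :
  (0 < M)%N -> 0 <= Rc ->
  (forall n, C n <= \sum_(0 <= l < n) (M ^ (n - l))%:R *
                (Rc + C l + (0 < l)%N%:R * C l.-1)) ->
  forall n, C n <= Rc * (4 * M%:R) ^+ n.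
Proof.
move=> M0 R0 Crec; elim/ltn_ind => n IH; apply: (le_trans (Crec n)).
have M1 : 1 <= M%:R :> R by rewrite ler1n.
have Mn0 k : 0 <= M%:R ^+ k :> R by rewrite exprn_ge0// (le_trans ler01).
apply: (@le_trans _ _ (\sum_(0 <= l < n) Rc * M%:R ^+ n * (3 * 4 ^+ l))).
  rewrite big_nat [leRHS]big_nat; apply: ler_sum => l /andP[_ ln].
  rewrite natrX -(subnK (ltnW ln)) addnK exprD.
  set a := M%:R ^+ (n - l).
  have a0 : 0 <= a by exact: Mn0.
  rewrite (_ : Rc * (a * M%:R ^+ l) * (3 * 4 ^+ l) =
    a * (3 * (Rc * (4 * M%:R) ^+ l))); last by rewrite exprMn; ring.
  rewrite ler_wpM2l//.
  have Cl := IH l ln.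
  have T1 : 1 <= (4 * M%:R) ^+ l :> R.
    by rewrite exprn_ege1// (le_trans M1)// ler_peMl// ?(le_trans ler01)//; lra.
  have RT : Rc <= Rc * (4 * M%:R) ^+ l by rewrite ler_peMr.
  have [l0|l0] := posnP l; first by rewrite mul0r; lra.
  have Cl1 : C l.-1 <= Rc * (4 * M%:R) ^+ l.
    rewrite (le_trans (IH l.-1 (leq_ltn_trans (leq_pred _) ln)))// ler_wpM2l//.
    by rewrite -[in leRHS](prednK l0) exprS ler_peMl// ?exprn_ge0 ?mulr_ge0//; lra.
  by rewrite mul1r; lra.
rewrite -mulr_sumr exprMn [4 ^+ n * _]mulrC mulrA ler_wpM2l ?mulr_ge0//.
elim: (n) => [|m IHm]; first by rewrite big_geq.
by rewrite big_nat_recr//= exprS; lra.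
Qed.

(** At [q = 1] the last inequality is strict, and this is the hypothesis on [M]
multiplied by [1 - s] after extraction of a square root. By continuity it survives
for [q = 1 - t]: the difference of the two sides is the gap [f] at [q = 1] minus
[2 * t] plus nonnegative terms. *)
Lemma rate_exists (R : realType) (s N M : R) : 0 <= s -> s < 1 -> 1 <= N ->
  (1 + s * (2 * N - 1)) ^+ 2 / (1 - s) ^+ 2 < M ->
  let r := (Num.sqrt M)^-1 in
  exists q, [/\ 0 < q < 1, r < q &
    s * (q - r) + s * N * (q + 1) * r <= q * (q - r)].
Proof.
move=> s0 s1 N1 MN r.
have h0 : 0 < 1 + s * (2 * N - 1) by rewrite ltr_pwDl// mulr_ge0//; lra.
have M0 : 0 < M.
  by rewrite (le_lt_trans _ MN)// divr_ge0 ?sqr_ge0.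
have sM0 : 0 < Num.sqrt M by rewrite sqrtr_gt0.
have r0 : 0 < r by rewrite invr_gt0.
have rM : r * Num.sqrt M = 1 by rewrite mulVf// gt_eqF.
have hM : 1 + s * (2 * N - 1) < Num.sqrt M * (1 - s).
  have s10 : 0 < 1 - s by rewrite subr_gt0.
  rewrite -(@ltr_pXn2r _ 2)// ?nnegrE ?(ltW h0)// ?mulr_ge0 ?ltW//.
  by rewrite exprMn sqr_sqrtr ?(ltW M0)// -ltr_pdivrMr// exprn_gt0.
have f1 : 0 < (1 - s) - r * (1 + s * (2 * N - 1)).
  rewrite subr_gt0.
  have := ltr_pM2l r0 (1 + s * (2 * N - 1)) (Num.sqrt M * (1 - s)).
  by rewrite hM mulrA rM mul1r.
have r1 : r < 1.
  have : r * 1 <= r * (1 + s * (2 * N - 1)).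
    by rewrite ler_wpM2l ?(ltW r0)// lerDl mulr_ge0//; lra.
  by rewrite mulr1; lra.
set f := (1 - s) - _ in f1.
pose t := Num.min (f / 2) ((1 - r) / 2).
have t0 : 0 < t by rewrite lt_min; apply/andP; split; lra.
have tf : t <= f / 2 by rewrite ge_min lexx.
have tr : t <= (1 - r) / 2 by rewrite ge_min lexx orbT.
exists (1 - t); split; [lra|lra|].
rewrite -subr_ge0.
rewrite (_ : _ - _ = f - 2 * t + t ^+ 2 + t * r + s * t + s * N * r * t); last first.
  by rewrite /f; ring.
have : 0 <= s * N * r * t by rewrite !mulr_ge0// ltW// (lt_le_trans ltr01).
have : 0 <= s * t by rewrite mulr_ge0// ltW.
have : 0 <= t * r by rewrite mulr_ge0// ltW.
have := sqr_ge0 t.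
lra.
Qed.

(** The constant [H] solves [r * (H + B * (q + 1) / q) = H * q], so [H * q ^ m] bounds
the weighted sum of the levels; the condition on [q] absorbs it. *)
Lemma rate_recursion (R : realType) (s N r q B kap : R) (n : nat) :
  0 <= s -> 0 <= N -> 0 < r < q -> 0 < B -> kap <= B ->
  s * (q - r) + s * N * (q + 1) * r <= q * (q - r) ->
  (0 < n)%N ->
  s * (B * q ^+ n.-1 + N * \sum_(0 <= l < n) r ^+ (n - l) *
     level_bound kap (fun l => B * q ^+ l) l) <= B * q ^+ n.
Proof.
move=> s0 N0 /andP[r0 rq] B0 kB qr; have q0 := lt_trans r0 rq.
have qr0 : 0 < q - r by rewrite subr_gt0.
pose H := B * (q + 1) * r / (q * (q - r)).
have GH m : \sum_(0 <= l < m) r ^+ (m - l) *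
     level_bound kap (fun l => B * q ^+ l) l <= H * q ^+ m.
  elim: m => [|m IH].
    by rewrite big_geq// expr0 mulr1 /H !mulr_ge0 ?invr_ge0 ?mulr_ge0 ?ltW// addr_gt0.
  rewrite big_nat_recr//= subSnn expr1.
  have -> : \sum_(0 <= l < m) r ^+ (m.+1 - l) * level_bound kap (fun l => B * q ^+ l) l
    = r * \sum_(0 <= l < m) r ^+ (m - l) * level_bound kap (fun l => B * q ^+ l) l.
    rewrite mulr_sumr big_nat [RHS]big_nat; apply: eq_bigr => l /andP[_ lm].
    by rewrite subSn ?(ltnW lm)// exprS mulrA.
  have tm : level_bound kap (fun l => B * q ^+ l) m <= B * q ^+ m * (q + 1) / q.
    rewrite ler_pdivlMr// /level_bound; case: m {IH} => [|m] /=.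
      by rewrite expr0 mulr1; nra.
    by rewrite exprS le_eqVlt; apply/orP; left; apply/eqP; ring.
  rewrite -mulrDr.
  apply: (@le_trans _ _ (r * (H * q ^+ m + B * q ^+ m * (q + 1) / q))).
    by rewrite ler_pM2l// lerD.
  rewrite le_eqVlt; apply/orP; left; apply/eqP; rewrite exprS /H; field.
  by rewrite !gt_eqF.
case: n => // n _ /=.
apply: (@le_trans _ _ (s * (B * q ^+ n + N * (H * q ^+ n.+1)))).
  by rewrite ler_wpM2l// lerD2l ler_wpM2l.
rewrite exprS (_ : s * _ = B * q ^+ n / (q - r) *
  (s * (q - r) + s * N * (q + 1) * r)); last first.
  by rewrite /H; field; rewrite !gt_eqF.
rewrite (_ : B * (q * q ^+ n) = B * q ^+ n / (q - r) * (q * (q - r))); last first.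
  by field; rewrite !gt_eqF.
by rewrite ler_wpM2l// divr_ge0 ?mulr_ge0 ?exprn_ge0 ?ltW.
Qed.

(** With [N eps = n + 1] the first positive index such that [B * q ^ (n + 1) <= eps], one
has [q ^ - n <= B / eps]. Some power [p] of [1 / q] exceeds [4 * M], so [(4 * M) ^ n]
is at most [(B / eps) ^ p]. *)
Lemma polynomial_complexity (R : realType) (B q : R) (M : nat) :
  1 <= B -> 0 < q < 1 -> (0 < M)%N ->
  exists (N : R -> nat) (c : R), forall eps : R, 0 < eps <= 1 ->
    [/\ (0 < N eps)%N, B * q ^+ N eps <= eps & (4 * M%:R) ^+ N eps <= c * eps `^ (- c)].
Proof.
move=> B1 /andP[q0 q1] M0.
have B0 : 0 < B by rewrite (lt_le_trans ltr01).
have q01 : 0 <= q < 1 by rewrite ltW.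
have M1 : 1 <= M%:R :> R by rewrite ler1n.
have L0 : 0 < 4 * M%:R :> R by lra.
have [p qp] := expr_lt_eps q01 (eps := (4 * M%:R)^-1) ltac:(by rewrite invr_gt0).
(* one constant for the factor and for the exponent *)
pose c : R := Num.max (4 * M%:R * B ^+ p) p%:R.
suff E eps : exists n : nat, 0 < eps <= 1 -> [/\ (0 < n)%N, B * q ^+ n <= eps &
    (4 * M%:R) ^+ n <= c * eps `^ (- c)].
  have [N HN] := choice E; exists N, c => eps e01; exact: HN.
have [/andP[e0 e1]|ne] := boolP (0 < eps <= 1); last by exists 0%N.
have ex : exists n, B * q ^+ n.+1 <= eps.
  have [n qn] := expr_lt_eps q01 (divr_gt0 e0 B0).
  exists n; rewrite mulrC -ler_pdivlMr// (le_trans _ (ltW qn))// exprS.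
  by rewrite ler_piMl ?exprn_ge0 ?ltW.
pose n := ex_minn ex.
have [Bn eBn] : B * q ^+ n.+1 <= eps /\ eps <= B * q ^+ n.
  (* for n = 0 the second bound reads eps <= B *)
  rewrite /n; case: ex_minnP => -[|m] Bm mmin; split => //.
    by rewrite expr0 mulr1 (le_trans e1).
  by rewrite leNgt; apply/negP => /ltW /mmin; rewrite ltnn.
exists n.+1 => _; split => //.
have qn0 : 0 < q ^+ n by rewrite exprn_gt0.
have Lp : (4 * M%:R) ^+ n <= (q ^+ n) ^- p.
  rewrite -exprM mulnC exprM -exprVn; apply: lerXn2r; rewrite ?nnegrE ?(ltW L0)//.
    by rewrite invr_ge0 exprn_ge0// ltW.
  by rewrite -[leLHS]invrK lef_pV2 ?posrE ?exprn_gt0 ?invr_gt0// ltW.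
have qB : (q ^+ n) ^- p <= B ^+ p * eps ^- p.
  rewrite -exprVn -[eps ^- p]exprVn -exprMn; apply: lerXn2r; rewrite ?nnegrE.
  - by rewrite invr_ge0 ltW.
  - by rewrite divr_ge0 ?ltW.
  - by rewrite -[leLHS]mul1r ler_pdivrMr// mulrAC ler_pdivlMr// mul1r.
have epsp : eps ^- p <= eps `^ (- c).
  rewrite -powR_mulrn ?(ltW e0)// -powRN; apply: ger_powR; first by rewrite e0.
  by rewrite lerN2 /c le_max lexx orbT.
have cM : 4 * M%:R * B ^+ p <= c by rewrite /c le_max lexx.
rewrite exprS (le_trans (ler_wpM2l (ltW L0) (le_trans Lp qB)))// mulrA.
rewrite (@le_trans _ _ (c * eps ^- p))//.
  by rewrite ler_wpM2r// invr_ge0 exprn_ge0// ltW.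
by rewrite ler_wpM2l// (le_trans _ cM)// mulr_ge0 ?exprn_ge0 ?ltW.
Qed.

(** * From one index d to the family *)

(** A positive variable cannot vanish almost surely. This forces [lambda] to be
positive, as the bounds on second moments require. *)
Lemma second_moment_gt0 (R : realType) (dO : measure_display)
    (Omega : measurableType dO) (P : probability Omega R) (Z : Omega -> R) (c : R) :
  (forall om, 0 < Z om) -> 0 <= c -> second_moment_le P Z (c ^+ 2) -> 0 < c.
Proof.
move=> Z0 c0 [mZ Zc]; rewrite lt_def c0 andbT; apply/eqP => c0'.
have mf : measurable_fun setT (fun om => ((Z om) ^+ 2)%:E).
  exact/measurable_EFinP/measurable_funX.
have : (\int[P]_om `|((Z om) ^+ 2)%:E| = 0)%E.
  apply/eqP; rewrite eq_le integral_ge0// andbT.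
  under eq_integral do rewrite gee0_abs ?lee_fin ?sqr_ge0//.
  by rewrite (le_trans Zc)// c0' expr0n.
move=> /(ae_eq_integral_abs P measurableT mf) [N [mN PN subN]].
have NT : N = setT.
  apply/seteqP; split => // om _; apply: subN => /= /(_ I) /eqP.
  by rewrite eqe sqrf_eq0 gt_eqF.
have := @probability_setT _ _ _ P; rewrite -NT [LHS]PN => /eqP.
by rewrite eqe eq_sym oner_eq0.
Qed.

Lemma adapted_joint (R : realType) (dO : measure_display) (Omega : measurableType dO)
    (F : Theta -> set (set Omega)) (dX : measure_display) (X : measurableType dX)
    (I : set Theta) (d : measure_display) (T : measurableType d)
    (f : X -> Omega -> T) :
  (forall th, F th `<=` measurable) -> adapted F I f ->
  measurable_fun setT (fun p : X * Omega => f p.1 p.2).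
Proof.
move=> F_sub mf.
have mid : measurable_fun setT (id : Omega -> g_sigma_algebraType (group_gen F I)).
  by apply: (grp_measurable F_sub (I := I) (T := g_sigma_algebraType (group_gen F I))).
apply: (measurableT_comp mf (g := fun p : X * Omega =>
  (p.1, p.2 : g_sigma_algebraType (group_gen F I)))).
apply: measurable_fun_pair; first exact: measurable_fst.
exact: (measurableT_comp mid measurable_snd).
Qed.

Lemma adapted_singleton (A : finType) (a0 : A) (dO : measure_display)
    (Omega : measurableType dO) (F : Theta -> set (set Omega)) (dX : measure_display)
    (X : measurableType dX) (th : Theta) (f : X -> A -> Omega -> X) :
  measurable_fun [set: X * discrete_copy a0 * g_sigma_algebraType (F th)]
    (fun p : X * discrete_copy a0 * g_sigma_algebraType (F th) => f p.1.1 p.1.2 p.2) ->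
  forall a, adapted F [set th] (fun x om => f x a om).
Proof.
move=> mf a; rewrite /adapted /group_gen bigcup_set1.
apply: (measurableT_comp mf
  (g := fun p : X * g_sigma_algebraType (F th) => ((p.1, a : discrete_copy a0), p.2))).
apply: measurable_fun_pair; last exact: measurable_snd.
apply: measurable_fun_pair; first exact: measurable_fst.
exact: measurable_cst.
Qed.

Theorem corollary4p2
  (R : realType)
  (M : nat) (M_gt0 : (0 < M)%N)
  (kappa : R) (kappa_ge0 : 0 <= kappa)
  (A : finType) (a0 : A)
  (D : Type) (D_nonempty : inhabited D)
  (dO : measure_display) (Omega : measurableType dO) (P : probability Omega R)
  (lambda delta Rcost : D -> R)
  (lambda_ge0 : forall d, 0 <= lambda d)
  (delta_ge0 : forall d, 0 <= delta d)
  (Rcost_ge0 : forall d, 0 <= Rcost d)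
  (dX : D -> measure_display) (X : forall d, measurableType (dX d))
  (w : forall d, X d -> R)
  (w_gt0 : forall d x, 0 < w d x)
  (w_meas : forall d, measurable_fun [set: X d] (w d))
  (g : forall d, X d -> A -> R)
  (g_meas : forall d, measurable_fun [set: X d * discrete_copy a0]
     (fun p : X d * discrete_copy a0 => g d p.1 p.2))
  (F : forall d : D, Theta -> set (set Omega))
  (F_sigma : forall d th, sigma_algebra [set: Omega] (F d th))
  (F_sub : forall d th, F d th `<=` measurable)
  (F_indep : forall d, independent_classes P (F d))
  (Y : forall d, Theta -> X d -> A -> Omega -> X d)
  (Y_iid : forall d, iid_fields P
     (fun (th : Theta) (om : Omega) (p : X d * A) => Y d th p.1 p.2 om))
  (Y_meas : forall d th,
     measurable_fun
       [set: X d * discrete_copy a0 * g_sigma_algebraType (F d th)]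
       (fun p : X d * discrete_copy a0 * g_sigma_algebraType (F d th) =>
          Y d th p.1.1 p.1.2 p.2))
  (s : \bar R)
  (s_def : s = ereal_sup (range (fun d : D => (lambda d * delta d)%:E)))
  (M_gt : (1 + fine s * (2 * #|A|%:R - 1)) ^+ 2 / (1 - fine s) ^+ 2 < M%:R)
  (g_bound : forall d (x : X d), fmax a0 (fun b => `|g d x b|) <= kappa * w d x)
  (w_growth : forall d (x : X d) (a : A),
     (sqrte 'E_P[(fun om => `|w d (Y d theta0 x a om)| ^+ 2)%R]
        <= (lambda d * w d x)%:E)%E)
  (s_lt1 : (s < 1)%E)
  (Q : forall d, nat -> Theta -> X d -> A -> Omega -> R)
  (Q_rec : forall d (n : nat) (x : X d) (a : A) (th : Theta) (om : Omega),
     Q d n th x a om =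
       g d x a +
       \sum_(0 <= l < n) delta d / (M ^ (n - l))%:R *
         \sum_(1 <= i < (M ^ (n - l)).+1)
           (fmax a0 (fun b => Q d l (theta_cat th l%:Z i%:Z)
               (Y d (theta_cat th l%:Z i%:Z) x a om) b om)
            - (0 < l)%N%:R *
              fmax a0 (fun b => Q d l.-1 (theta_cat th (- l%:Z) i%:Z)
               (Y d (theta_cat th l%:Z i%:Z) x a om) b om)))
  (C : nat -> D -> R)
  (C_ge0 : forall n d, 0 <= C n d)
  (C_rec : forall n d,
     C n d <= \sum_(0 <= l < n) (M ^ (n - l))%:R *
                (Rcost d + C l d + (0 < l)%N%:R * C l.-1 d)) :
  (forall d, exists! Qd : X d -> A -> R,
     bellman_solution P a0 (w d) (g d) (delta d) (Y d theta0) Qd)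
  /\
  (forall Qsol : (forall d, X d -> A -> R),
     (forall d, bellman_solution P a0 (w d) (g d) (delta d) (Y d theta0)
                  (Qsol d)) ->
     exists (N : R -> nat) (c : R),
       forall eps : R, 0 < eps <= 1 ->
         (0 < N eps)%N /\
         forall d : D,
           C (N eps) d <= c * Rcost d * eps `^ (- c) /\
           (ereal_sup (range (fun x : X d =>
              sqrte ('E_P[(fun om => fmax a0 (fun a =>
                         `|Qsol d x a - Q d (N eps) theta0 x a om| ^+ 2))%R]
                     * ((`|w d x| ^+ 2)^-1)%:E)))
            <= eps%:E)%E).
Proof.
have [d0] := D_nonempty.
have le_s d : ((lambda d * delta d)%:E <= s)%E.
  by rewrite s_def; apply: ereal_sup_ubound; exists d.
have sE : s = (fine s)%:E.
  rewrite fineK// fin_numElt (lt_trans s_lt1 (ltry _)) andbT.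
  by rewrite (lt_le_trans _ (le_s d0))// ltNyr.
set S := fine s in M_gt sE.
have rho_le d : delta d * lambda d <= S.
  by have := le_s d; rewrite sE lee_fin mulrC.
have S_ge0 : 0 <= S by rewrite (le_trans _ (rho_le d0))// mulr_ge0.
have S_lt1 : S < 1 by move: s_lt1; rewrite sE lte_fin.
have rho_lt1 d : delta d * lambda d < 1 by exact: le_lt_trans S_lt1.
have Y_adapted d th a : adapted (F d) [set th] (fun x om => Y d th x a om).
  exact: (adapted_singleton (a0 := a0) (f := Y d th)).
have Y_joint d a := @adapted_joint R _ _ _ _ _ _ _ _ _ (F_sub d) (Y_adapted d theta0 a).
have Y_law d th th' := (Y_iid d).2 th th'.
have g_sec d a : measurable_fun setT (g d ^~ a).
  by move: a; apply/(measurable_discrete_sections a0).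
have w_moment d x a :
    second_moment_le P (fun om => w d (Y d theta0 x a om)) ((lambda d * w d x) ^+ 2).
  split.
    exact: (measurableT_comp (w_meas d) (measurable_fun_pair2 x (Y_joint d a))).
  have := w_growth d x a; rewrite unlock.
  under eq_integral do rewrite real_normK ?num_real//.
  set E := (\int[P]_om _)%E => lE.
  have E0 : (0 <= E)%E by apply: integral_ge0 => om _; rewrite lee_fin sqr_ge0.
  rewrite -[E]sqr_sqrte// EFin_expe lee_sqr ?sqrte_ge0// lee_fin.
  by rewrite mulr_ge0// ltW.
have lambda_gt0 d : 0 < lambda d.
  have x0 : X d by exact: point.
  rewrite -(pmulr_lgt0 _ (w_gt0 d x0)); apply: second_moment_gt0 (w_moment d x0 a0) => //.
  by rewrite mulr_ge0// ltW.
(* kappa may be zero, whereas the second moment bounds must be positive *)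
pose kap := kappa + 1.
have kap_gt0 : 0 < kap by rewrite ltr_wpDl.
have g_le d : weighted_le (w d) (g d) kap.
  move=> x b; rewrite (le_trans (le_fmax a0 (fun b => `|g d x b|) b))//.
  by rewrite (le_trans (g_bound d x))// ler_pM2r// lerDl.
have solP d q := bellman_solutionP (w := w d) a0 (g d) (delta d) (w_gt0 d)
  (Y_joint d) (w_moment d) q.
split=> [d|Qsol sol].
  exists (bellman_fixpoint a0 P (g d) (delta d) (Y d theta0)); split.
    apply/solP; split.
    - exact: (bellman_fixpoint_meas a0 (w_gt0 d) (lambda_gt0 d) (delta_ge0 d) (rho_lt1 d)
        (g_sec d) (g_le d) (Y_joint d) (w_moment d)).
    - eexists; exact: (bellman_fixpoint_bound a0 (w_gt0 d) (lambda_gt0 d) (delta_ge0 d)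
        (rho_lt1 d) (g_sec d) (g_le d) (Y_joint d) (w_moment d)).
    - exact: (bellman_fixpointE a0 (w_gt0 d) (lambda_gt0 d) (delta_ge0 d)
        (rho_lt1 d) (g_sec d) (g_le d) (Y_joint d) (w_moment d)).
  move=> q /solP[mq [K qK] qE]; apply/funext => x; apply/funext => a.
  apply: (fixed_unique (w_gt0 d) (lambda_gt0 d) (delta_ge0 d) (rho_lt1 d)
    (Y_joint d) (w_moment d) _ mq _ qK _ qE).
  - exact: (bellman_fixpoint_meas a0 (w_gt0 d) (lambda_gt0 d) (delta_ge0 d) (rho_lt1 d)
      (g_sec d) (g_le d) (Y_joint d) (w_moment d)).
  - exact: (bellman_fixpoint_bound a0 (w_gt0 d) (lambda_gt0 d) (delta_ge0 d)
      (rho_lt1 d) (g_sec d) (g_le d) (Y_joint d) (w_moment d)).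
  - exact: (bellman_fixpointE a0 (w_gt0 d) (lambda_gt0 d) (delta_ge0 d)
      (rho_lt1 d) (g_sec d) (g_le d) (Y_joint d) (w_moment d)).
have A1 : 1 <= #|A|%:R :> R by rewrite ler1n; apply/card_gt0P; exists a0.
have [q [q01 rq qcond]] := rate_exists S_ge0 S_lt1 A1 M_gt.
have q_gt0 : 0 < q by case/andP: q01.
pose K := kap / (1 - S).
have K_ge0 : 0 <= K by rewrite divr_ge0 ?(ltW kap_gt0)// subr_ge0 ltW.
(* K bounds every solution and kap bounds g, hence B bounds the initial error *)
pose B := kap + K.
have B_ge1 : 1 <= B by rewrite /B /kap -addrA addrCA lerDl addr_ge0.
have B_gt0 : 0 < B by rewrite (lt_le_trans ltr01).
have [N [c Nc]] := polynomial_complexity B_ge1 q01 M_gt0.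
exists N, c => eps eps01; have [N_gt0 NB NC] := Nc eps eps01.
have [eps0 _] := andP eps01.
split=> // d; split.
  rewrite mulrAC [c * _ * _]mulrC.
  apply: (le_trans (complexity_bound M_gt0 (Rcost_ge0 d) (fun n => C_rec n d) _)).
  by rewrite ler_wpM2l.
have [mq [K' qK'] qE] := (solP d _).1 (sol d).
have qK : weighted_le (w d) (Qsol d) K.
  move=> x b; have := fixed_bound (w_gt0 d) (lambda_gt0 d) (delta_ge0 d)
    (rho_lt1 d) (g_le d) (Y_joint d) (w_moment d) mq qK' qE x b.
  move=> /le_trans; apply; rewrite ler_pM2r// ler_pM2l// lef_pV2 ?posrE ?subr_gt0//.
  by rewrite lerD2l lerN2.
have Qd_rec n x a th om : Q d n th x a om = g d x a + \sum_(p <- levels M n)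
    delta d / (M ^ (n - p.1))%:R * level_term a0 (Y d) (Q d) th p om (x, a).
  rewrite Q_rec /levels big_allpairs_dep /=; congr (_ + _).
  by apply: eq_bigr => l _; rewrite mulr_sumr.
have M_gt0R : 0 < M%:R :> R by rewrite ltr0n.
have r_gt0 : 0 < (Num.sqrt M%:R)^-1 :> R by rewrite invr_gt0 sqrtr_gt0.
have rec n : (0 < n)%N -> delta d * lambda d * (B * q ^+ n.-1 + #|A|%:R *
     \sum_(0 <= l < n) (Num.sqrt M%:R)^-1 ^+ (n - l) *
        level_bound kap (fun l => B * q ^+ l) l) <= B * q ^+ n.
  move=> n0; apply: le_trans (rate_recursion (kap := kap) S_ge0 (le_trans ler01 A1)
    _ B_gt0 _ qcond n0); last 2 first.
  - by rewrite r_gt0.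
  - by rewrite /B lerDl.
  rewrite ler_wpM2r//.
  rewrite addr_ge0 ?mulr_ge0 ?exprn_ge0 ?(ltW B_gt0) ?(ltW q_gt0)//.
  apply: sumr_ge0 => l _; rewrite mulr_ge0 ?exprn_ge0 ?(ltW r_gt0)//.
  by rewrite ltW// level_bound_gt0// => m; rewrite mulr_gt0// exprn_gt0.
have err := error_geometric (F_sigma d) (F_sub d) (F_indep d) (g_sec d) (Y_adapted d)
  (Y_law d) Qd_rec M_gt0 (w_gt0 d) (w_meas d) (lambda_gt0 d) (delta_ge0 d) kap_gt0
  (g_le d) (w_moment d) mq K_ge0 qK qE B_gt0 q_gt0 (lexx _) rec.
apply: ge_ereal_sup => _ [x _ <-]; rewrite unlock.
have := err (N eps) theta0 x; set E := (\int[P]_om _)%E => E_le.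
have wx2 : 0 < w d x ^+ 2 by rewrite exprn_gt0.
rewrite real_normK ?num_real//.
have -> : eps%:E = sqrte (eps ^+ 2)%:E.
  by rewrite /= sqrtr_sqr gtr0_norm.
rewrite lee_sqrt ?lee_fin ?sqr_ge0//.
apply: (@le_trans _ _ (((B * q ^+ N eps * w d x) ^+ 2)%:E * ((w d x ^+ 2)^-1)%:E)%E).
  by apply: lee_wpmul2r; rewrite ?lee_fin ?invr_ge0 ?(ltW wx2).
rewrite -EFinM lee_fin [X in X / _]exprMn mulfK ?gt_eqF//.
have Bq0 : 0 <= B * q ^+ N eps by rewrite ltW// mulr_gt0// exprn_gt0.
by rewrite ler_sqr// nnegrE ltW.
Qed.
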